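(* Let $X, Y$ be totally bounded metric spaces. Then $$\mathrm{d_b}\big(\mathsf{dgm}(\mathrm{H}(\mathbb{R}\mathrm{ips}(X))),\ \mathsf{dgm}(\mathrm{H}(\mathbb{R}\mathrm{ips}(Y)))\big)\ \leq\ 2\,\mathrm{d_{GH}}(X, Y)$$ and $$\mathrm{d_b}\big(\mathsf{dgm}(\mathrm{H}(\check{\mathbb{C}}\mathrm{ech}(X))),\ \mathsf{dgm}(\mathrm{H}(\check{\mathbb{C}}\mathrm{ech}(Y)))\big)\ \leq\ 2\,\mathrm{d_{GH}}(X, Y).$$
   Context: Fix a field $\mathbf{k}$; $\mathrm{H}$ denotes (total) simplicial homology with coefficients in $\mathbf{k}$. A persistence module $\mathbb{V}$ is a family of $\mathbf{k}$-vector spaces $(V_a)_{a\in\mathbf{R}}$ with linear maps $v_a^b:V_a\to V_b$ for $a\le b$ such that $v_a^a=\mathrm{id}$ and $v_b^c\circ v_a^b=v_a^c$ for $a\le b\le c$. It is q-tame if $r(a,b):=\mathrm{rank}(v_a^b)<\infty$ whenever $a<b$. Persistence diagram of a q-tame module: for $-\infty\le p<q<r<s\le+\infty$ and $R=[p,q]\times[r,s]$ put $\mu(R)=r(q,r)-r(p,r)-r(q,s)+r(p,s)$, where a rank is $0$ if one of its arguments is $\pm\infty$. Then $\mathsf{dgm}(\mathbb{V})$ is the multiset of points $(x,y)$ with $-\infty\le x<y\le+\infty$ in which $(x,y)$ has multiplicity $\min\mu(R)$, the minimum over such rectangles $R$ containing $(x,y)$ in their interior relative to the extended plane $[-\infty,+\infty]^2$.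 Bottleneck distance: an $\varepsilon$-matching between two such multisets is a partial bijection between them (counting multiplicity) such that matched points are at $\ell^\infty$-distance at most $\varepsilon$ (a point with an infinite coordinate is matched only with a point having the same infinite coordinate(s), the finite coordinates differing by at most $\varepsilon$), and every unmatched point $(x,y)$ satisfies $\frac12(y-x)\le\varepsilon$. $\mathrm{d_b}$ is the infimum of the $\varepsilon\geq 0$ for which an $\varepsilon$-matching exists. A correspondence $C:X\rightrightarrows Y$ is a subset of $X\times Y$ projecting surjectively onto both factors; $\mathrm{dis}(C)=\sup\{|d_X(x,x')-d_Y(y,y')|:(x,y),(x',y')\in C\}$ (with $\sup\emptyset=0$); $\mathrm{d_{GH}}(X,Y)=\frac12\inf_C\mathrm{dis}(C)\in[0,+\infty]$, the infimum over all correspondences. A metric space is totally bounded if for every $\varepsilon>0$ it has a finite subset $F$ such that every point is at distance $<\varepsilon$ from some point of $F$. For $a\in\mathbf{R}$, $\mathrm{Rips}(X,a)$ is the simplicial complex whose simplices are the nonempty finite subsets $\{x_0,\dots,x_k\}\subseteq X$ with $d_X(x_i,x_j)\le a$ for all $i,j$ (including $i=j$). $\check{\mathrm{C}}\mathrm{ech}(X,a)$ is the simplicial complex whose simplices are the nonempty finite subsets $\{x_0,\dots,x_k\}\subseteq X$ with $\bigcap_i B(x_i,a)\neq\emptyset$, where $B(x,a)=\{x'\in X:d_X(x,x')\le a\}$. Both are empty for $a<0$. $\mathrm{H}(\mathbb{R}\mathrm{ips}(X))$ and $\mathrm{H}(\check{\mathbb{C}}\mathrm{ech}(X))$ are the persistence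 modules $(\mathrm{H}(\mathrm{Rips}(X,a)))_{a}$ and $(\mathrm{H}(\check{\mathrm{C}}\mathrm{ech}(X,a)))_{a}$ with maps induced by inclusions; for totally bounded $X$ they are q-tame, so their diagrams are defined. *)

(* Defs.v *)
From HB Require Import structures.
From mathcomp Require Import all_boot all_order all_algebra finmap.
From mathcomp Require Import all_classical all_reals.
From mathcomp Require Import topology ereal.
From mathcomp Require Import generic_quotient ring_quotient wochoice.
(* The notations of monalg clash with those of topology. *)
From mathcomp Require monalg.
Import -(notations) monalg.

Set Implicit Arguments.
Unset Strict Implicit.
Unset Printing Implicit Defensive.

Import Order.TTheory GRing.Theory Num.Theory.

Local Open Scope classical_set_scope.
Local Open Scope ring_scope.

Section QuotientModule.
Variables (k : fieldType) (V : lmodType k) (W : submodClosed V).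

Definition submod_pred : {pred V} := fun v => v \in W.

Fact submod_pred_zmod : zmod_closed submod_pred.
Proof.
split=> [|u v uW vW]; first exact: rpred0.
by rewrite unfold_in rpredD// -scaleN1r rpredZ.
Qed.

HB.instance Definition _ := GRing.isZmodClosed.Build V submod_pred
  submod_pred_zmod.

Definition quotmod := Quotient.quot submod_pred.

HB.instance Definition _ := GRing.Zmodule.on quotmod.

Definition quotmod_pi (v : V) : quotmod := (\pi_(Quotient.quot submod_pred) v)%qT.

Definition quotmod_repr (x : quotmod) : V := repr (x : Quotient.quot submod_pred).

Lemma quotmod_reprK : cancel quotmod_repr quotmod_pi.
Proof. by move=> x; rewrite /quotmod_pi /quotmod_repr reprK. Qed.

Lemma quotmod_eqP (u v : V) :
  reflect (quotmod_pi u = quotmod_pi v) (u - v \in W).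
Proof. by rewrite -[_ \in _]/(u - v \in submod_pred) Quotient.idealrBE; apply: eqP. Qed.

Lemma quotmod_piB : zmod_morphism quotmod_pi.
Proof. by move=> x y; rewrite /quotmod_pi raddfB. Qed.

Lemma quotmod_piD u v : quotmod_pi (u + v) = quotmod_pi u + quotmod_pi v.
Proof. by rewrite /quotmod_pi raddfD. Qed.

Definition quotmod_scale (a : k) (x : quotmod) : quotmod :=
  quotmod_pi (a *: quotmod_repr x).

Lemma quotmod_scale_pi a v : quotmod_scale a (quotmod_pi v) = quotmod_pi (a *: v).
Proof.
apply/quotmod_eqP; rewrite -scalerBr rpredZ//.
by apply/quotmod_eqP; rewrite quotmod_reprK.
Qed.

Fact quotmod_scaleA a b x :
  quotmod_scale a (quotmod_scale b x) = quotmod_scale (a * b) x.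
Proof. by rewrite -(quotmod_reprK x) !quotmod_scale_pi scalerA. Qed.

Fact quotmod_scale1 : left_id 1 quotmod_scale.
Proof. by move=> x; rewrite -(quotmod_reprK x) quotmod_scale_pi scale1r. Qed.

Fact quotmod_scaleDr : right_distributive quotmod_scale +%R.
Proof.
move=> a x y; rewrite -(quotmod_reprK x) -(quotmod_reprK y).
by rewrite -quotmod_piD !quotmod_scale_pi scalerDr quotmod_piD.
Qed.

Fact quotmod_scaleDl x :
  {morph quotmod_scale^~ x : a b / a + b >-> a + b}.
Proof.
move=> a b /=; rewrite -(quotmod_reprK x).
by rewrite !quotmod_scale_pi scalerDl quotmod_piD.
Qed.

HB.instance Definition _ := GRing.Zmodule_isLmodule.Build k quotmod
  quotmod_scaleA quotmod_scale1 quotmod_scaleDr quotmod_scaleDl.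

Lemma quotmod_piZ a v : quotmod_pi (a *: v) = a *: quotmod_pi v.
Proof. by rewrite -quotmod_scale_pi. Qed.

End QuotientModule.

Section QuotientMap.
Variables (k : fieldType) (V V' : lmodType k).
Variables (W : submodClosed V) (W' : submodClosed V').
Variables (f : {linear V -> V'}) (fW : forall v, v \in W -> f v \in W').

Definition quotmod_map of (forall v, v \in W -> f v \in W') :=
  fun x : quotmod W => quotmod_pi W' (f (quotmod_repr x)).

Lemma quotmod_map_pi v : quotmod_map fW (quotmod_pi W v) = quotmod_pi W' (f v).
Proof.
apply/quotmod_eqP; rewrite -linearB fW//.
by apply/quotmod_eqP; rewrite quotmod_reprK.
Qed.

Fact quotmod_map_linear : linear (quotmod_map fW).
Proof.
move=> a x y; rewrite -(quotmod_reprK x) -(quotmod_reprK y).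
rewrite -quotmod_piZ -quotmod_piD !quotmod_map_pi linearP.
by rewrite quotmod_piD quotmod_piZ.
Qed.

HB.instance Definition _ :=
  GRing.isLinear.Build k (quotmod W) (quotmod W') *:%R (quotmod_map fW)
    quotmod_map_linear.

End QuotientMap.

Record simplicial_complex (T : choiceType) := SimplicialComplex {
  simplices :> set {fset T};
  simplices_neq0 : forall s, simplices s -> s != fset0;
  simplices_sub : forall s t,
    simplices s -> (t `<=` s)%fset -> t != fset0 -> simplices t
}.

(* A total order on the vertices, used only to orient the simplices.  It
   depends on the vertex type alone, so inclusions of complexes on the same
   vertices preserve orientations. *)
Definition vertex_le (T : choiceType) : rel T := sval (well_ordering_principle T).

Definition vertex_lt (T : choiceType) (v w : T) := vertex_le v w && (v != w).

Lemma vertex_lt_neg (T : choiceType) (v w : T) :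
  v != w -> vertex_lt w v = ~~ vertex_lt v w.
Proof.
move=> vw; rewrite /vertex_lt vw eq_sym vw !andbT /vertex_le.
case: (well_ordering_principle T) => r /=/withinW rwo.
have rT := @wo_chainW _ _ predT (rwo _).
have rA := @wo_chain_antisymmetric _ _ predT (rwo _).
have := rT v w isT isT; have := rA v w isT isT.
by case: (r v w); case: (r w v) => //= /(_ isT) /eqP; rewrite (negbTE vw).
Qed.

Section Chains.
Variables (k : fieldType) (T : choiceType).

(* The free vector space on the finite sets of vertices. *)
Local Notation chain_space := (malg {fset T} k).

(* The boundary of s = [v_0, ..., v_n], v_0 < ... < v_n, is the sum of the
   (-1)^i [v_0, ..., v_(i-1), v_(i+1), ..., v_n]; the exponent below is the
   position i of v in s.  The boundary of a vertex is 0 (no augmentation). *)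
Definition simplex_boundary (s : {fset T}) : chain_space :=
  if (#|` s| <= 1)%N then 0
  else \sum_(v <- s)
         mkmalgU (s `\ v)%fset ((-1) ^+ #|` [fset w in s | vertex_lt w v]%fset|).

Definition boundary (c : chain_space) : chain_space :=
  \sum_(s <- msupp c) mcoeff s c *: simplex_boundary s.

Lemma boundaryEw (D : {fset {fset T}}) (c : chain_space) : (msupp c `<=` D)%fset ->
  boundary c = \sum_(s <- D) mcoeff s c *: simplex_boundary s.
Proof.
move=> cD; apply: big_fset_incl => // s _ /mcoeff_outdom->.
exact: scale0r.
Qed.

Fact boundary_linear : linear boundary.
Proof.
move=> a c d; pose D := (msupp (a *: c + d) `|` (msupp c `|` msupp d))%fset.
rewrite !(@boundaryEw D) ?fsubsetUl//; last 2 first.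
- by rewrite fsubsetU// fsubsetUr orbT.
- by rewrite fsubsetU// fsubsetUl orbT.
rewrite scaler_sumr -big_split/=; apply: eq_bigr => s _.
by rewrite scalerA -scalerDl mcoeffD mcoeffZ.
Qed.

HB.instance Definition _ := GRing.isLinear.Build k chain_space chain_space *:%R
  boundary boundary_linear.

Lemma boundaryU s a : boundary (mkmalgU s a) = a *: simplex_boundary s.
Proof.
rewrite (@boundaryEw [fset s]%fset) ?msuppU; last by case: eqP.
by rewrite big_seq_fset1 mcoeffUU.
Qed.

Lemma boundaryK c : boundary (boundary c) = 0.
Proof.
rewrite {2}/boundary linear_sum/= big1// => s _; rewrite linearZ/=.
suff -> : boundary (simplex_boundary s) = 0 by rewrite scaler0.
rewrite {1}/simplex_boundary; case: leqP => [_|s1]; first by rewrite linear0.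
rewrite linear_sum/=.
pose pos (t : {fset T}) (v : T) := #|` [fset w in t | @vertex_lt T w v]%fset|.
have [s2|s2] := leqP #|` s| 2.
  rewrite big_seq big1// => v vs; rewrite boundaryU /simplex_boundary.
  rewrite ifT ?scaler0// -ltnS (leq_trans _ s2)//.
  by rewrite [X in (_ < X)%N](cardfsD1 v) vs.
pose F (v w : T) : chain_space := (-1) ^+ (pos s v + pos (s `\ v)%fset w) *:
  mkmalgU ((s `\ v) `\ w)%fset 1.
have -> : \sum_(v <- s) boundary (mkmalgU (s `\ v)%fset ((-1) ^+ pos s v)) =
  \sum_(v <- s) \sum_(w <- s | w != v) F v w.
  rewrite !big_seq; apply: eq_bigr => v vs; rewrite boundaryU /simplex_boundary.
  rewrite ifF; last first.
    by apply/negbTE; rewrite -ltnNge -ltnS; move: s2; rewrite (cardfsD1 v) vs.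
  rewrite scaler_sumr [RHS]big_mkcond (big_fsetD1 v vs)/= eqxx add0r.
  rewrite big_seq [RHS]big_seq; apply: eq_bigr => w.
  rewrite in_fsetD1 => /andP[-> _].
  rewrite /F exprD -scalerA; congr (_ *: _).
  by apply/malgP => t; rewrite mcoeffZ !mcoeffU mulrnAr mulr1.
have -> : \sum_(v <- s) \sum_(w <- s | w != v) F v w =
  \sum_(v <- s) \sum_(w <- s | vertex_lt w v) F v w +
  \sum_(v <- s) \sum_(w <- s | vertex_lt v w) F v w.
  rewrite -big_split/=; apply: eq_bigr => v _.
  rewrite (bigID (fun w => vertex_lt w v))/=; congr (_ + _); apply: eq_bigl => w.
    by rewrite andb_idl// /vertex_lt => /andP[].
  have [->|wv] := eqVneq w v; first by rewrite /vertex_lt eqxx andbF.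
  by rewrite -vertex_lt_neg.
rewrite [X in _ + X](exchange_big_dep predT)//= -big_split/= big_seq big1// => v vs.
rewrite -big_split/= big_seq_cond big1// => w /andP[ws wv].
have vw : v != w by rewrite eq_sym; case/andP: wv.
have vw' : ~~ vertex_lt v w by rewrite -vertex_lt_neg.
rewrite /F (_ : (s `\ w) `\ v = (s `\ v) `\ w)%fset; last first.
  by apply/fsetP => u; rewrite !inE andbCA.
rewrite -scalerDl.
have -> : pos (s `\ v)%fset w = pos s w.
  rewrite /pos; congr (#|` _|); apply/fsetP => u; rewrite !inE.
  by case: eqP => //= ->; rewrite (negbTE vw') andbF.
have -> : pos s v = (pos (s `\ w)%fset v).+1.
  rewrite /pos (cardfsD1 w) !inE ws wv add1n; congr (#|` _|.+1).
  by apply/fsetP => u; rewrite !inE andbA.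
by rewrite addnC addnS exprS mulN1r addNr scale0r.
Qed.

Definition is_chain (K : simplicial_complex T) (c : chain_space) :=
  forall s, s \in msupp c -> simplices K s.

Fact is_chain0 (K : simplicial_complex T) : is_chain K 0.
Proof. by move=> s; rewrite msupp0. Qed.

Fact is_chainP (K : simplicial_complex T) a c d :
  is_chain K c -> is_chain K d -> is_chain K (a *: c + d).
Proof.
move=> Kc Kd s /(fsubsetP (msuppD_le _ _)); rewrite inE => /orP[|/Kd//].
by move=> /(fsubsetP (msuppZ_le _ _))/Kc.
Qed.

End Chains.

Section Homology.
Variables (k : fieldType) (T : choiceType).

Local Notation chain_space := (malg {fset T} k).

Section Cycles.
Variable K : simplicial_complex T.

Definition is_cycle : {pred chain_space} :=
  fun c => `[< is_chain K c /\ boundary c = 0 >].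

Fact is_cycle_submod : subsemimod_closed is_cycle.
Proof.
apply: GRing.submod_closed_semi.
split; first by apply/asboolP; split; [exact: is_chain0|rewrite linear0].
move=> a c d /asboolP[Kc c0] /asboolP[Kd d0]; apply/asboolP; split.
  exact: is_chainP.
by rewrite linearP/= c0 d0 scaler0 addr0.
Qed.

HB.instance Definition _ := GRing.isSubmodClosed.Build k chain_space
  is_cycle is_cycle_submod.

Record cycle := Cycle { cycle_val :> chain_space; _ : is_cycle cycle_val }.

HB.instance Definition _ := [isSub for cycle_val].
HB.instance Definition _ := [Choice of cycle by <:].
HB.instance Definition _ := [SubChoice_isSubLmodule of cycle by <:].

Definition is_boundary : {pred cycle} :=
  fun z => `[< exists2 c : chain_space, is_chain K c & boundary c = z >].

Fact is_boundary_submod : subsemimod_closed is_boundary.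
Proof.
apply: GRing.submod_closed_semi.
split; first by apply/asboolP; exists 0; [exact: is_chain0|rewrite linear0].
move=> a z w /asboolP[c Kc cz] /asboolP[d Kd dw]; apply/asboolP.
exists (a *: c + d); first exact: is_chainP.
by rewrite linearP/= cz dw.
Qed.

HB.instance Definition _ := GRing.isSubmodClosed.Build k cycle
  is_boundary is_boundary_submod.

(* Chains of all degrees are taken together; since the boundary is homogeneous
   of degree -1, this quotient is the direct sum of the homology spaces in the
   various degrees, that is, total homology. *)
Definition homology : lmodType k := quotmod is_boundary.

End Cycles.

Section Inclusion.
Variables (K L : simplicial_complex T) (KL : K `<=` L).

Fact is_cycleS c : is_cycle K c -> is_cycle L c.
Proof.
move=> /asboolP[Kc c0]; apply/asboolP; split=> // s /Kc; exact: KL.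
Qed.

Definition cycle_incl (z : cycle K) : cycle L := Cycle (is_cycleS (valP z)).

Fact cycle_incl_linear : linear cycle_incl.
Proof. by move=> a z w; apply/val_inj. Qed.

HB.instance Definition _ := GRing.isLinear.Build k (cycle K) (cycle L) *:%R
  cycle_incl cycle_incl_linear.

Fact cycle_incl_boundary z :
  z \in @is_boundary K -> cycle_incl z \in @is_boundary L.
Proof.
move=> /asboolP[c Kc cz]; apply/asboolP; exists c => // s /Kc; exact: KL.
Qed.

Definition homology_incl : {linear homology K -> homology L} :=
  quotmod_map cycle_incl_boundary.

End Inclusion.
End Homology.

Record persistence_module (R : realType) (k : fieldType) := PersistenceModule {
  pm_space :> R -> lmodType k;
  pm_map : forall a b, a <= b -> {linear pm_space a -> pm_space b};
  pm_map_id : forall a (aa : a <= a) v, pm_map aa v = v;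
  pm_map_comp : forall a b c (ab : a <= b) (bc : b <= c) (ac : a <= c) v,
    pm_map bc (pm_map ab v) = pm_map ac v
}.

Section FilteredHomology.
Variables (R : realType) (k : fieldType) (T : choiceType).
Variables (K : R -> simplicial_complex T).
Variable (K_mono : forall a b, a <= b -> K a `<=` K b).

Let hspace a := homology k (K a).

Let hmap a b (ab : a <= b) : {linear hspace a -> hspace b} :=
  homology_incl k (K_mono ab).

Fact filtered_homology_id a (aa : a <= a) v : hmap aa v = v.
Proof.
rewrite -(quotmod_reprK v) [LHS]quotmod_map_pi; congr quotmod_pi.
exact/val_inj.
Qed.

Fact filtered_homology_comp a b c (ab : a <= b) (bc : b <= c) (ac : a <= c) v :
  hmap bc (hmap ab v) = hmap ac v.
Proof.
rewrite -(quotmod_reprK v) [X in hmap bc X]quotmod_map_pi.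
rewrite [LHS]quotmod_map_pi [RHS]quotmod_map_pi; congr quotmod_pi.
exact/val_inj.
Qed.

Definition filtered_homology : persistence_module R k :=
  PersistenceModule filtered_homology_id filtered_homology_comp.

End FilteredHomology.

Section Rank.
Variables (k : fieldType) (U V : lmodType k).

Definition has_rank (f : {linear U -> V}) (n : nat) :=
  exists e : 'I_n -> V,
    [/\ forall i, range f (e i),
        forall c : 'I_n -> k, \sum_i c i *: e i = 0 -> forall i, c i = 0
      & forall v, range f v -> exists c : 'I_n -> k, v = \sum_i c i *: e i].

(* Equal to 0 when the rank is infinite. *)
Definition rank (f : {linear U -> V}) : nat := xget 0%N [set n | has_rank f n].

End Rank.

Section Diagram.
Variable R : realType.

(* A multiset of points of the extended plane, as a multiplicity function. *)
Definition multiset := \bar R * \bar R -> nat.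

Section DiagramOfModule.
Variables (k : fieldType) (V : persistence_module R k).

Definition q_tame := forall a b (ab : a <= b), a < b ->
  exists n, has_rank (pm_map V ab) n.

(* A rank with an infinite argument is 0; rect_measure never has b < a. *)
Definition erank (a b : \bar R) : nat :=
  match a, b with
  | a'%:E, b'%:E =>
      if @idP (a' <= b') is ReflectT ab then rank (pm_map V ab) else 0%N
  | _, _ => 0%N
  end.

Definition rect_measure (p q r s : \bar R) : int :=
  (erank q r)%:Z - (erank p r)%:Z - (erank q s)%:Z + (erank p s)%:Z.

Definition rect_measures_around (z : \bar R * \bar R) : set int :=
  [set m | exists p q r s : \bar R,
    [/\ (p < q)%E, (q < r)%E, (r < s)%E,
        ([set` `[p, q]] `*` [set` `[r, s]])° z &
        m = rect_measure p q r s]].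

(* Meaningful for q-tame V: the measures are then natural numbers and their
   minimum exists.  For other V the value may be arbitrary. *)
Definition dgm : multiset := fun z =>
  if (z.1 < z.2)%E then
    xget 0%N [set n : nat | rect_measures_around z n%:Z /\
                lbound (rect_measures_around z) n%:Z]
  else 0%N.

End DiagramOfModule.

Definition ecoord_close (eps : R) (x y : \bar R) : Prop :=
  match x, y with
  | a%:E, b%:E => `|a - b| <= eps
  | +oo%E, +oo%E | -oo%E, -oo%E => True
  | _, _ => False
  end.

Definition point_close (eps : R) (z w : \bar R * \bar R) : Prop :=
  ecoord_close eps z.1 w.1 /\ ecoord_close eps z.2 w.2.

Definition near_diagonal (eps : R) (z : \bar R * \bar R) : Prop :=
  (2^-1%:E * (z.2 - z.1) <= eps%:E)%E.

(* The copies (z, 0), ..., (z, A z - 1) of the points z of A. *)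
Definition copies (A : multiset) : set ((\bar R * \bar R) * nat) :=
  [set u | (u.2 < A u.1)%N].

Definition is_matching (A B : multiset) (eps : R)
    (M : set (((\bar R * \bar R) * nat) * ((\bar R * \bar R) * nat))) : Prop :=
  [/\ M `<=` copies A `*` copies B,
      (forall u v v', M (u, v) -> M (u, v') -> v = v') /\
        (forall u u' v, M (u, v) -> M (u', v) -> u = u'),
      forall u v, M (u, v) -> point_close eps u.1 v.1,
      forall u, copies A u -> ~ (exists v, M (u, v)) -> near_diagonal eps u.1
    & forall v, copies B v -> ~ (exists u, M (u, v)) -> near_diagonal eps v.1].

Definition bottleneck (A B : multiset) : \bar R :=
  ereal_inf [set eps%:E | eps in
    [set eps : R | 0 <= eps /\ exists M, is_matching A B eps M]].

End Diagram.

Section Metric.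
Variable R : realType.

Definition totally_bounded (X : metricType R) :=
  forall eps : R, 0 < eps ->
    exists2 F : set X, finite_set F &
      forall x, exists2 y, F y & mdist x y < eps.

Section GromovHausdorff.
Variables X Y : metricType R.

Definition correspondence (C : set (X * Y)) :=
  (forall x, exists y, C (x, y)) /\ (forall y, exists x, C (x, y)).

(* The element 0 only matters for empty C. *)
Definition distortion (C : set (X * Y)) : \bar R :=
  ereal_sup (0%E |` [set `|mdist u.1 v.1 - mdist u.2 v.2|%:E | u in C & v in C]).

Definition gromov_hausdorff : \bar R :=
  (2^-1%:E * ereal_inf [set distortion C | C in correspondence])%E.

End GromovHausdorff.

Section Complexes.
Variable X : metricType R.

Definition closed_metric_ball (x : X) (a : R) : set X := [set y | mdist x y <= a].

Definition rips_simplex (a : R) : set {fset X} :=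
  [set s | s != fset0 /\ forall x y, x \in s -> y \in s -> mdist x y <= a].

Fact rips_simplex_sub a s t :
  rips_simplex a s -> (t `<=` s)%fset -> t != fset0 -> rips_simplex a t.
Proof.
move=> [_ sa] /fsubsetP ts t0; split=> // x y /ts xs /ts ys; exact: sa.
Qed.

Definition Rips (a : R) : simplicial_complex X :=
  SimplicialComplex (fun s => @proj1 _ _) (@rips_simplex_sub a).

Fact Rips_mono a b : a <= b -> Rips a `<=` Rips b.
Proof. by move=> ab s [s0 sa]; split=> // x y xs ys; apply: le_trans (sa _ _ _ _) ab. Qed.

Definition cech_simplex (a : R) : set {fset X} :=
  [set s | s != fset0 /\ \bigcap_(x in [set` s]) closed_metric_ball x a !=set0].

Fact cech_simplex_sub a s t :
  cech_simplex a s -> (t `<=` s)%fset -> t != fset0 -> cech_simplex a t.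
Proof. by move=> [_ [z sz]] /fsubsetP ts t0; split=> //; exists z => x /ts/sz. Qed.

Definition Cech (a : R) : simplicial_complex X :=
  SimplicialComplex (fun s => @proj1 _ _) (@cech_simplex_sub a).

Fact Cech_mono a b : a <= b -> Cech a `<=` Cech b.
Proof.
move=> ab s [s0 [z sz]]; split=> //; exists z => x /sz xz.
exact: le_trans xz ab.
Qed.

Definition rips_homology (k : fieldType) : persistence_module R k :=
  filtered_homology k Rips_mono.

Definition cech_homology (k : fieldType) : persistence_module R k :=
  filtered_homology k Cech_mono.

End Complexes.
End Metric.

(* Main.v *)
(* A correspondence C of finite distortion eps makes the two filtrations
   eps-interleaved: choosing partners of points sends simplices to simplices of
   the target at scale eps larger, and a round trip is chain homotopic to the
   inclusion.  Finite nets give q-tameness in the same way.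

   For stability, put r_U(a,b) = rank(U_a -> U_b), likewise r_V, and use the
   mixed ranks r_I(a,b) = rank(U_a -> V_(b+eps)); r_I is the rank function of
   the image of U in the shift of V.  By Frobenius' inequality
   rk(BA) + rk(CB) <= rk(B) + rk(CBA), for a' <= a < b
     r_U(a,b+2eps) - r_U(a',b+2eps) <= r_I(a,b) - r_I(a',b) <= r_U(a,b) - r_U(a',b),
   and dually for deaths, with V in place of U.  Letting a' and a tend to x from
   both sides, these compare numbers of bars born at x, so the n-th longest bar
   of U born at x can be matched with the n-th longest bar of I born at x, the
   death decreasing by at most 2eps.  Dually the bars of I are matched with those
   of V by death time, and the composite is the required matching.  This is the
   induced matching of Bauer and Lesnick, read off from ranks only. *)
Require Import Defs.
From HB Require Import structures.
From mathcomp Require Import all_boot all_order all_algebra finmap.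
From mathcomp Require Import all_classical all_reals.
From mathcomp Require Import topology ereal.
From mathcomp Require Import lra zify.
From mathcomp Require monalg.
Import -(notations) monalg.

Set Implicit Arguments.
Unset Strict Implicit.
Unset Printing Implicit Defensive.

Import Order.TTheory GRing.Theory Num.Theory numFieldTopology.Exports.

Local Open Scope classical_set_scope.
Local Open Scope ring_scope.

(** * Diagrams of rank functions *)

Section RankFunctions.
Variable R : realType.
Implicit Types (x y a b p q r s : \bar R) (E F : \bar R -> \bar R -> nat).

Local Open Scope ereal_scope.

(** The last clause makes every rectangle measure nonnegative; with [p = -oo] or [s = +oo] it
    becomes monotonicity in one of the arguments. *)
Definition rank_like E :=
  [/\ forall b, E -oo b = 0%N, forall a, E a +oo = 0%N &
      forall p q r s, p <= q -> q < r -> r <= s ->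
        (E p r + E q s <= E q r + E p s)%N].

(** Together with [x < q] this says that [x] is interior to [[p, q]] relative to the extended line,
    in which [-oo] is interior to [[-oo, q]]. [rside] mirrors it at [+oo]. *)
Definition lside x p := p < x \/ p = -oo.
Definition rside y s := y < s \/ s = +oo.

(* Abstracting the ranks keeps [lia] from comparing extended reals. *)
Ltac rank_lia := repeat match goal with
  | |- context [?f ?E ?a ?b] =>
      match type of b with \bar _ =>
        match type of (f E a b) with nat => generalize (f E a b) end end
  | |- context [?E ?a ?b] =>
      match type of b with \bar _ =>
        match type of (E a b) with nat => generalize (E a b) end end
  end; clear; lia.

Lemma lside_max x p p' : lside x p -> lside x p' -> lside x (maxe p p').
Proof. by case: (leP p p'). Qed.

Lemma rside_min y s s' : rside y s -> rside y s' -> rside y (mine s s').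
Proof. by case: (leP s s'). Qed.

Lemma lside_lt x p q : lside x p -> x < q -> p < q.
Proof.
move=> [px xq|->]; first exact: lt_trans xq.
by move=> xq; apply: le_lt_trans xq; rewrite leNye.
Qed.

Lemma rside_lt y s r : rside y s -> r < y -> r < s.
Proof.
move=> [ys ry|->]; first exact: lt_trans ys.
by move=> ry; apply: lt_le_trans ry _; rewrite leey.
Qed.

Lemma lte_between x y : x < y -> exists z : R, x < z%:E < y.
Proof.
move: x y => [x| |] [y| |]//=; rewrite ?lte_fin => xy.
- by exists ((x + y) / 2)%R; rewrite !lte_fin !midf_lt.
- by exists (x + 1)%R; rewrite lte_fin ltry ltrDl ltr01.
- by exists (y - 1)%R; rewrite lte_fin ltNyr ltrBlDr ltrDl ltr01.
- by exists 0%R; rewrite ltNyr ltry.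
Qed.

(* [jump E x b] is the limit of [E q b - E p b] for [p] to the left and [q] to
   the right of [x]: the number of bars born at [x] and alive at [b]. *)
Definition jump_at E x b n := exists p0 q0, [/\ lside x p0, x < q0, q0 < b &
  forall p q, lside x p -> p0 <= p -> x < q -> q <= q0 ->
    E q b = (n + E p b)%N].

Definition jump E x b := xget 0%N [set n | jump_at E x b n].

(** Raising [p] or lowering [q] can only decrease the natural number [E q b - E p b]. A window
    around [x] on which it is least therefore keeps this value on all smaller windows. *)
Lemma jumpP E x b : rank_like E -> x < b -> jump_at E x b (jump E x b).
Proof.
move=> [E0 Ey Emu] xb.
suff nP : exists n, jump_at E x b n.
  exact: (@xgetPex _ 0%N [set n | jump_at E x b n] nP).
have Eq q q' : q <= q' -> q' < b -> (E q b <= E q' b)%N.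
  move=> qq' q'b; have := Emu q q' b +oo qq' q'b (leey _).
  by rewrite !Ey !addn0.
pose S n := `[< exists p q, [/\ lside x p, x < q, q < b & E q b = (n + E p b)%N] >].
have [n0 n0S] : exists n, S n.
  have [q /andP[xq qb]] := lte_between xb.
  exists (E q%:E b); apply/asboolP; exists -oo, q%:E; split=> //; first by right.
  by rewrite E0 addn0.
case: (ex_minnP (ex_intro _ n0 n0S)) => n /asboolP[p0 [q0 [xp0 xq0 q0b Epq]]] nmin.
exists n, p0, q0; split=> // p q xp p0p xq qq0.
have qb := le_lt_trans qq0 q0b.
have Epq1 : (E p b <= E q b)%N by apply: Eq => //; exact/ltW/(lside_lt xp).
have := Eq _ _ p0p (lside_lt xp (lt_trans xq0 q0b)).
have := Eq _ _ qq0 q0b.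
suff : (n <= E q b - E p b)%N by move: Epq Epq1; rank_lia.
by apply: nmin; apply/asboolP; exists p, q; split=> //; rewrite subnK.
Qed.

Lemma jumpy E x : rank_like E -> x < +oo -> jump E x +oo = 0%N.
Proof.
move=> Er xy; have [p [q [xp xq qy /(_ p q xp (lexx _) xq (lexx _))]]] := jumpP Er xy.
by case: Er => _ Ey _; rewrite !Ey addn0 => <-.
Qed.

(** On the intersection of the windows of the two jumps, the hypothesis compares the two differences
    directly. *)
Lemma jump_le2 E F x b b' : rank_like E -> rank_like F -> x < b -> x < b' ->
  (forall p q, p <= q -> q < b -> q < b' -> (E q b + F p b' <= F q b' + E p b)%N) ->
  (jump E x b <= jump F x b')%N.
Proof.
move=> Er Fr xb xb' EF.
have [p [q [xp xq qb H]]] := jumpP Er xb.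
have [p' [q' [xp' xq' q'b' H']]] := jumpP Fr xb'.
have xP := lside_max xp xp'.
have xQ : x < mine q q' by rewrite lt_min xq.
move: (H (maxe p p') (mine q q')) (H' (maxe p p') (mine q q')).
rewrite !le_max !ge_min !lexx !orbT /= => /(_ xP isT xQ isT) H1 /(_ xP isT xQ isT) H2.
have := EF (maxe p p') (mine q q') (ltW (lside_lt xP xQ)).
rewrite !gt_min qb q'b' orbT => /(_ isT isT); move: H1 H2; rank_lia.
Qed.

Lemma jump_le E x b b' : rank_like E -> x < b -> b <= b' -> (jump E x b' <= jump E x b)%N.
Proof.
move=> Er xb bb'; apply: jump_le2 => //; first exact: lt_le_trans bb'.
move=> p q pq qb' qb; case: Er => _ _ /(_ p q b b' pq qb bb'); rank_lia.
Qed.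

(** [n] is the measure of a rectangle with [z] in its interior; negative terms are moved across so
    that only natural numbers occur. *)
Definition rect_count E z n := exists p q r s,
  [/\ lside z.1 p, z.1 < q, q < r, r < z.2 & rside z.2 s] /\
  (n + (E p r + E q s) = E q r + E p s)%N.

Definition mult_spec E z n :=
  rect_count E z n /\ forall m, rect_count E z m -> (n <= m)%N.

Definition diagram E z :=
  if (z.1 < z.2)%E then xget 0%N [set n | mult_spec E z n] else 0%N.

Lemma mult_spec_uniq E z m n : mult_spec E z m -> mult_spec E z n -> m = n.
Proof. by move=> [m1 m2] [n1 n2]; apply/eqP; rewrite eqn_leq m2// n2. Qed.

(** As [jump E x] is nonincreasing with values in [nat], it is constant just before and just after
    [y]. The multiplicity of [(x, y)] is the drop between these values: the number of bars born at
    [x] that die at [y]. *)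
Lemma diagramE E x y : rank_like E -> x < y ->
  exists n r0 s0, [/\ x < r0, r0 < y, rside y s0,
    forall s, rside y s -> s <= s0 -> jump E x s = n &
    forall r, r0 <= r -> r < y -> jump E x r = (n + diagram E (x, y))%N].
Proof.
move=> Er xy.
have [r1 /andP[xr1 r1y]] := lte_between xy.
have rsx s : rside y s -> x < s by move=> ys; exact: rside_lt xy.
have [n [s0 [ys0 sn]]] : exists (n : nat) s0, rside y s0 /\
    forall s, rside y s -> s <= s0 -> jump E x s = n.
  pose S n := `[< exists s, rside y s /\ jump E x s = n >].
  have Sub n : S n -> (n <= jump E x r1%:E)%N.
    move=> /asboolP[s [ys <-]]; apply: jump_le => //; apply/ltW.
    exact: rside_lt r1y.
  have Sex : exists n, S n.
    by exists (jump E x +oo); apply/asboolP; exists +oo; split=> //; right.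
  case: (ex_maxnP Sex Sub) => n /asboolP[s [ys sn]] nmax.
  exists n, s; split=> // s' ys' s's; apply/eqP; rewrite eqn_leq nmax/=; last first.
    by apply/asboolP; exists s'.
  by rewrite -sn; apply: jump_le => //; exact: rsx.
have [m [r0 [xr0 r0y rm]]] : exists (m : nat) r0, [/\ x < r0, r0 < y &
    forall r, r0 <= r -> r < y -> jump E x r = m].
  pose S m := `[< exists r, [/\ x < r, r < y & jump E x r = m] >].
  have Sex : exists m, S m.
    by exists (jump E x r1%:E); apply/asboolP; exists r1%:E; split.
  case: (ex_minnP Sex) => m /asboolP[r [xr ry rm]] mmin.
  exists m, r; split=> // r' rr' r'y; apply/eqP; rewrite eqn_leq mmin/= ?andbT; last first.
    by apply/asboolP; exists r'; split=> //; exact: lt_le_trans rr'.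
  by rewrite -rm; apply: jump_le.
have nm : (n <= m)%N.
  rewrite -(rm r0)// -(sn s0)//; apply: jump_le => //; exact/ltW/(rside_lt ys0).
exists n, r0, s0; split=> // r r0r ry; rewrite rm//.
have spec : mult_spec E (x, y) (m - n)%N.
  split=> [|k [p [q [r' [s [/= [xp xq qr r'y ys] kE]]]]]].
    have [p [q [xp xq qr0 pq]]] := jumpP Er xr0.
    have [p' [q' [xp' xq' _ pq']]] := jumpP Er (rsx _ ys0).
    exists (maxe p p'), (mine q q'), r0, s0; split.
      split=> //=; first exact: lside_max.
        by rewrite lt_min xq.
      by rewrite gt_min qr0.
    have xP := lside_max xp xp'; have xQ : x < mine q q' by rewrite lt_min xq.
    move: (pq (maxe p p') (mine q q') xP) (pq' (maxe p p') (mine q q') xP).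
    rewrite !le_max !ge_min !lexx !orbT => /(_ isT xQ isT) -> /(_ isT xQ isT) ->.
    by rewrite (rm r0)// (sn s0)//; move: nm; rank_lia.
  have xr' := lt_trans xq qr.
  have rM : maxe r' r0 < y by rewrite gt_max r'y.
  have sM := rside_min ys ys0.
  rewrite -(rm (maxe r' r0))// ?le_max ?lexx ?orbT//.
  rewrite -(sn (mine s s0))// ?ge_min ?lexx ?orbT//.
  suff : (jump E x (maxe r' r0) + (E p r' + E q s) <=
          jump E x (mine s s0) + (E q r' + E p s))%N by move: kE; rank_lia.
  have xM : x < maxe r' r0 by rewrite lt_max xr'.
  have [p1 [q1 [xp1 xq1 q1r pq1]]] := jumpP Er xM.
  have [p2 [q2 [xp2 xq2 q2s pq2]]] := jumpP Er (rsx _ sM).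
  (* The given rectangle is cut at the heights [maxe r' r0] and [mine s s0], and its middle strip at
     [P] and [Q]. All pieces have nonnegative measure, so the inner one, of measure [m - n], has at
     most the measure of the whole. *)
  pose P := maxe p (maxe p1 p2); pose Q := mine q (mine q1 q2).
  have xP : lside x P by do !apply: lside_max.
  have xQ : x < Q by rewrite !lt_min xq xq1.
  have := pq1 P Q xP; have := pq2 P Q xP.
  rewrite !le_max !ge_min !lexx !orbT => /(_ isT xQ isT) e2 /(_ isT xQ isT) e1.
  have [_ _ Emu] := Er.
  have pP : p <= P by rewrite le_max lexx.
  have Qq : Q <= q by rewrite ge_min lexx.
  have rs : maxe r' r0 <= mine s s0 by rewrite ltW// (rside_lt sM).
  have PQ := lside_lt xP xQ.
  have qs : q < mine s s0 by apply: lt_le_trans rs; rewrite lt_max qr.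
  have h1 := Emu p q r' (maxe r' r0) (ltW (lside_lt xp xq)) qr.
  have h2 := Emu p q (maxe r' r0) (mine s s0) (ltW (lside_lt xp xq)).
  have h3 := Emu p q (mine s s0) s (ltW (lside_lt xp xq)) qs.
  have Qr : Q < maxe r' r0 by apply: le_lt_trans Qq _; rewrite lt_max qr.
  have h4 := Emu p P (maxe r' r0) (mine s s0) pP (lt_trans PQ Qr) rs.
  have h5 := Emu Q q (maxe r' r0) (mine s s0) Qq.
  move: h1 h2 h3 h4 h5; rewrite !lt_max qr/= !le_max !ge_min !lexx/=.
  move=> /(_ isT) h1 /(_ isT rs) h2 /(_ isT) h3 h4 /(_ isT rs) h5.
  by move: h1 h2 h3 h4 h5 e1 e2; rank_lia.
rewrite /diagram/= xy (mult_spec_uniq (@xgetPex _ 0%N _ (ex_intro _ _ spec)) spec).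
by rewrite subnKC.
Qed.

(* Bars born at [x] are numbered by decreasing length; [bar_code E z c n] says
   that the [c]-th copy of [z] gets number [n]. *)
Definition bar_code E z c n :=
  [/\ (c < diagram E z)%N, (exists2 s, rside z.2 s & (jump E z.1 s + c = n)%N),
      forall s, rside z.2 s -> (jump E z.1 s + c <= n)%N &
      forall r, z.1 < r -> r < z.2 -> (n < jump E z.1 r)%N].

Lemma diagram_lt E z c : (c < diagram E z)%N -> z.1 < z.2.
Proof. by rewrite /diagram; case: ifP. Qed.

(** The number is [c] plus the value of the jump just after the death time: bars that die later come
    first. *)
Lemma bar_code_ex E z c : rank_like E -> (c < diagram E z)%N -> exists n, bar_code E z c n.
Proof.
case: z => x y Er cD; have xy := diagram_lt cD.
have [n [r0 [s0 [xr0 r0y ys0 sn rn]]]] := diagramE Er xy.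
exists (n + c)%N; split=> //=.
- by exists s0; rewrite ?sn.
- move=> s ys; rewrite leq_add2r -(sn (mine s s0)).
  + apply: jump_le => //; last by rewrite ge_min lexx.
    by rewrite lt_min !(rside_lt _ xy).
  + exact: rside_min.
  + by rewrite ge_min lexx orbT.
- move=> r xr ry; have rM : maxe r r0 < y by rewrite gt_max ry.
  apply: (@leq_trans (jump E x (maxe r r0))).
    by rewrite rn ?le_max ?lexx ?orbT// ltn_add2l.
  by apply: jump_le => //; rewrite le_max lexx.
Qed.

(** Bar [n] dies at the supremum of the times at which more than [n] bars born at [x] are alive; its
    copy index is [n] minus the jump just after that time. *)
Lemma bar_code_decode E x b n : rank_like E -> x < b -> (n < jump E x b)%N ->
  exists y c, bar_code E (x, y) c n.
Proof.
move=> Er xb nb; pose S := [set b | x < b /\ (n < jump E x b)%N].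
have xy : x < ereal_sup S by apply: (lt_le_trans xb); apply: ereal_sup_ubound; split.
have small s : rside (ereal_sup S) s -> (jump E x s <= n)%N.
  move=> ys; rewrite leqNgt; apply/negP => ns.
  have xs := rside_lt ys xy.
  have sS : s <= ereal_sup S by apply: ereal_sup_ubound; split.
  case: ys => [|sy]; first by rewrite ltNge sS.
  by move: ns xs; rewrite sy => + xoo; rewrite jumpy.
have big r : x < r -> r < ereal_sup S -> (n < jump E x r)%N.
  move=> xr /ereal_sup_gt[b' [xb' nb'] rb'].
  by apply: leq_trans nb' _; apply: jump_le => //; exact: ltW.
have [k [r0 [s0 [xr0 r0y ys0 sn rn]]]] := diagramE Er xy.
have kn : (k <= n)%N by rewrite -(sn s0)//; exact: small.
exists (ereal_sup S), (n - k)%N; split=> //=.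
- by have := big _ xr0 r0y; rewrite rn//; move: kn; rank_lia.
- by exists s0; rewrite ?sn// subnKC.
- move=> s ys.
  suff : (jump E x s <= k)%N by move: kn; rank_lia.
  have ysM := rside_min ys ys0.
  rewrite -(sn _ ysM) ?ge_min ?lexx ?orbT//.
  by apply: jump_le => //; [exact: rside_lt xy|rewrite ge_min lexx].
Qed.

Lemma bar_code_fun E z c n n' : rank_like E ->
  bar_code E z c n -> bar_code E z c n' -> n = n'.
Proof.
move=> Er [_ [s ys sn] ns _] [_ [s' ys' sn'] ns' _].
have := ns' _ ys; have := ns _ ys'; move: sn sn'; rank_lia.
Qed.

Lemma bar_code_small E z c n s : bar_code E z c n -> rside z.2 s -> (jump E z.1 s <= n)%N.
Proof. by move=> [_ _ H _] /H; apply: leq_trans; exact: leq_addr. Qed.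

(** At a time between [y] and a larger [y'], one code would give at most [n] living bars and the
    other more than [n]. *)
Lemma bar_code_le E x y y' c c' n :
  bar_code E (x, y) c n -> bar_code E (x, y') c' n -> y' <= y.
Proof.
move=> H [_ _ _ /= nJ]; rewrite leNgt; apply/negP => yy'.
have [s /andP[ys sy']] := lte_between yy'.
have xy : x < y by case: H => /diagram_lt.
have := bar_code_small H (or_introl ys); have := nJ _ (lt_trans xy ys) sy'.
by rewrite /= ltnNge => /negP.
Qed.

Lemma bar_code_inj E x y y' c c' n : bar_code E (x, y) c n ->
  bar_code E (x, y') c' n -> y = y' /\ c = c'.
Proof.
move=> H H'; have yy' : y = y'.
  by apply/eqP; rewrite eq_le (bar_code_le H H') (bar_code_le H' H).
split=> //; move: H H'; rewrite yy' => -[_ [s ys sn] ns _] [_ [s' ys' sn'] ns' _].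
have := ns' _ ys; have := ns _ ys'; move: sn sn'; rank_lia.
Qed.

(** Bars with equal birth and equal number are matched. The hypotheses give
    [jump F x b <= jump E x b] and [jump E x (b + d) <= jump F x b], so the [n]-th bar of [F] at [x]
    exists only if that of [E] does, and ends earlier by at most [d]. *)
Lemma half_matching E F (d : R) : rank_like E -> rank_like F ->
  (forall p q b, p <= q -> q < b -> (F q b + E p b <= E q b + F p b)%N) ->
  (forall p q (b : R), p <= q -> q < b%:E ->
     (E q (b%:E + d%:E)%E + F p b%:E <= F q b%:E + E p (b%:E + d%:E)%E)%N) ->
  (0 <= d)%R ->
  exists M : set (((\bar R * \bar R) * nat) * ((\bar R * \bar R) * nat)),
  [/\ M `<=` copies (diagram E) `*` copies (diagram F),
      (forall u v v', M (u, v) -> M (u, v') -> v = v') /\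
        (forall u u' v, M (u, v) -> M (u', v) -> u = u'),
      forall u v, M (u, v) ->
        [/\ u.1.1 = v.1.1, v.1.2 <= u.1.2 & u.1.2 <= v.1.2 + d%:E],
      forall v, copies (diagram F) v -> exists u, M (u, v) &
      forall u, copies (diagram E) u -> u.1.1 + d%:E < u.1.2 -> exists v, M (u, v)].
Proof.
move=> Er Fr FE EF d0.
have JFE x b : x < b -> (jump F x b <= jump E x b)%N.
  by move=> xb; apply: jump_le2 => // p q pq qb _; have := FE p q b pq qb; rank_lia.
have JEF x (b : R) : x < b%:E -> (jump E x (b%:E + d%:E)%E <= jump F x b%:E)%N.
  move=> xb; apply: jump_le2 => //.
    by apply: (lt_le_trans xb); rewrite leeDl.
  by move=> p q pq _ qb; have := EF p q b pq qb; rank_lia.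
exists [set w | [/\ w.1.1.1 = w.2.1.1 & exists n,
  bar_code E w.1.1 w.1.2 n /\ bar_code F w.2.1 w.2.2 n]].
split.
- by move=> [[z c] [w c']] /= [_ [n [[? _ _ _] [? _ _ _]]]].
- split.
    move=> [[x y] c] [[x1 y1] c1] [[x2 y2] c2] /= [<- [n [E1 F1]]] [<- [m [E2 F2]]].
    move: F2; rewrite -(bar_code_fun Er E1 E2) => F2.
    by have [-> ->] := bar_code_inj F1 F2.
  move=> [[x1 y1] c1] [[x2 y2] c2] [[x y] c] /= [-> [n [E1 F1]]] [-> [m [E2 F2]]].
  move: E2; rewrite -(bar_code_fun Fr F1 F2) => E2.
  by have [-> ->] := bar_code_inj E1 E2.
- move=> [[x y] c] [[x1 y1] c1] /= [<- [n [E1 F1]]].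
  have xy : x < y by case: E1 => /diagram_lt.
  have xy1 : x < y1 by case: F1 => /diagram_lt.
  split=> //.
    rewrite leNgt; apply/negP => /lte_between[s /andP[ys sy1]].
    have xs := lt_trans xy ys.
    have := bar_code_small E1 (or_introl ys); case: F1 => _ _ _ /= /(_ s%:E xs sy1).
    by have := JFE _ _ xs; rank_lia.
  rewrite leNgt; apply/negP => /lte_between[s /andP[ys sy]].
  have y1s : y1 < (s - d)%:E by rewrite EFinB lteBrDr.
  have := bar_code_small F1 (or_introl y1s).
  have := JEF _ _ (lt_trans xy1 y1s); rewrite -EFinD subrK.
  have xs : x < s%:E by apply: lt_trans xy1 (lt_le_trans y1s _); rewrite lee_fin gerBl.
  by case: E1 => _ _ _ /= /(_ s%:E xs sy); rank_lia.
- move=> [[x y] c] /= yc; have xy := diagram_lt yc.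
  have [n H] := bar_code_ex Fr yc.
  have [b /andP[xb yb]] := lte_between xy.
  have [|y1 [c1 H1]] := @bar_code_decode E x b%:E n Er xb.
    by case: H => _ _ _ /= /(_ b%:E xb yb) H; apply: leq_trans H (JFE _ _ xb).
  by exists ((x, y1), c1); split=> //; exists n.
(* A bar of [E] longer than [d] is still alive at some [s > x + d], so more than [n] bars of [F]
   born at [x] are alive at [s - d]. *)
- move=> [[x y] c] /= yc /lte_between[s /andP[xs sy]]; have xy := diagram_lt yc.
  have [n H] := bar_code_ex Er yc.
  have xsd : x < (s - d)%:E by rewrite EFinB lteBrDr.
  have xs' : x < s%:E by apply: (lt_le_trans xsd); rewrite lee_fin gerBl.
  have [|y1 [c1 H1]] := @bar_code_decode F x (s - d)%:E n Fr xsd.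
    case: H => _ _ _ /= /(_ s%:E xs' sy) H; apply: leq_trans H _.
    by have := JEF _ _ xsd; rewrite -EFinD subrK.
  by exists ((x, y1), c1); split=> //; exists n.
Qed.

(** * Duality, shifts, and composition of matchings *)

Lemma eq_diagram E F z w : (z.1 < z.2) = (w.1 < w.2) ->
  (forall n, rect_count E z n <-> rect_count F w n) -> diagram E z = diagram F w.
Proof.
move=> zw EF; rewrite /diagram zw; congr (if _ then xget _ _ else _).
apply/seteqP; split=> n [/EF nE nmin]; split=> // m /EF; exact: nmin.
Qed.

(** Negating both axes exchanges births and deaths: the bar [(x, y)] becomes [(- y, - x)]. *)
Definition dual_rank E a b := E (- b) (- a).

Lemma dual_rank_like E : rank_like E -> rank_like (dual_rank E).
Proof.
move=> [E0 Ey Emu]; split=> [b|a|p q r s pq qr rs]; rewrite /dual_rank.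
- exact: Ey.
- exact: E0.
by rewrite (addnC (E (- r) (- q))) [leqLHS]addnC [leqRHS]addnC Emu ?leeN2 ?lteN2.
Qed.

Lemma lsideN x p : lside (- x) (- p) <-> rside x p.
Proof.
rewrite /lside /rside lteN2; split=> -[?|pE]; try by left.
  by right; move/(congr1 oppe): pE; rewrite oppeK.
by right; rewrite pE.
Qed.

Lemma rsideN x p : rside (- x) (- p) <-> lside x p.
Proof. by rewrite -lsideN !oppeK. Qed.

Lemma rect_count_dual E x y n : rect_count E (x, y) n -> rect_count (dual_rank E) (- y, - x) n.
Proof.
move=> [p [q [r [s [/= [xp xq qr ry ys] nE]]]]].
exists (- s), (- r), (- q), (- p); rewrite /dual_rank !oppeK; split.
  by split=> /=; rewrite ?lteN2 ?lsideN ?rsideN.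
by move: nE; rank_lia.
Qed.

Lemma diagram_dual E x y : diagram (dual_rank E) (- y, - x) = diagram E (x, y).
Proof.
apply: eq_diagram => /=; first by rewrite lteN2.
move=> n; split; last exact: rect_count_dual.
move/rect_count_dual; rewrite !oppeK (_ : dual_rank (dual_rank E) = E)//.
by apply/funext => a; apply/funext => b; rewrite /dual_rank !oppeK.
Qed.

(** The rank function of the module reindexed by [a -> a + d]; every bar moves by [- d]. *)
Definition shift_rank (d : R) E a b := E (a + d%:E) (b + d%:E).

Lemma shift_rank_like d E : rank_like E -> rank_like (shift_rank d E).
Proof.
move=> [E0 Ey Emu]; split=> [b|a|p q r s pq qr rs]; rewrite /shift_rank.
- exact: E0.
- exact: Ey.
by rewrite Emu ?leeD2r// lteD2rE.
Qed.

Lemma rect_count_shift d E x y n :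
  rect_count (shift_rank d E) (x, y) n -> rect_count E (x + d%:E, y + d%:E) n.
Proof.
move=> [p [q [r [s [/= [xp xq qr ry ys] nE]]]]].
exists (p + d%:E), (q + d%:E), (r + d%:E), (s + d%:E); split=> //.
rewrite /= !lteD2rE//; split=> //.
  by case: xp => [?|->]; [left; rewrite lteD2rE|right].
by case: ys => [?|->]; [left; rewrite lteD2rE|right].
Qed.

Lemma diagram_shift d E x y :
  diagram (shift_rank d E) (x, y) = diagram E (x + d%:E, y + d%:E).
Proof.
apply: eq_diagram => /= [|n]; first by rewrite lteD2rE.
split; first exact: rect_count_shift.
have := @rect_count_shift (- d) (shift_rank d E) (x + d%:E) (y + d%:E) n.
rewrite EFinN !addeK// (_ : shift_rank (- d) _ = E)//.
by apply/funext => a; apply/funext => b; rewrite /shift_rank EFinN !subeK.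
Qed.

Lemma adde_EFinNK x (d : R) : x + (- d)%:E + d%:E = x.
Proof. by rewrite EFinN subeK. Qed.

(** The two inequalities together force both coordinates to be finite. *)
Lemma near_diagonal_le (eps : R) z : z.1 < z.2 -> z.2 <= z.1 + (2 * eps)%:E -> near_diagonal eps z.
Proof.
case: z => [[x| |] [y| |]]//=; rewrite /near_diagonal/= -?EFinD ?lte_fin ?lee_fin
  => xy yx; try by move: yx; rewrite ?leye_eq ?leeNy_eq.
lra.
Qed.

(** The first two inequalities match [E] with [I] at equal births. The last two, read in the dual,
    match the shift of [F] with [I] at equal deaths. The composite through [I] is the matching
    sought. *)
Lemma rank_matching E F I (eps : R) : (0 <= eps)%R ->
  rank_like E -> rank_like F -> rank_like I ->
  (forall p q b, p <= q -> q < b -> (I q b + E p b <= E q b + I p b)%N) ->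
  (forall p q (b : R), p <= q -> q < b%:E ->
     (E q (b%:E + (2 * eps)%:E)%E + I p b%:E <= I q b%:E + E p (b%:E + (2 * eps)%:E)%E)%N) ->
  (forall a r s, a < r -> r <= s ->
     (I a r + shift_rank eps F a s <= shift_rank eps F a r + I a s)%N) ->
  (forall (a : R) r s, a%:E < r -> r <= s ->
     (shift_rank eps F (a%:E - (2 * eps)%:E)%E r + I a%:E s <=
      I a%:E r + shift_rank eps F (a%:E - (2 * eps)%:E)%E s)%N) ->
  exists M, is_matching (diagram E) (diagram F) eps M.
Proof.
move=> eps0 Er Fr Ir h1 h2 h3 h4.
have eps20 : (0 <= 2 * eps)%R by rewrite mulr_ge0.
have [M [M1 [M2 M3] M4 M5 M6]] := half_matching Er Ir h1 h2 eps20.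
have := half_matching (dual_rank_like (shift_rank_like eps Fr)) (dual_rank_like Ir) _ _ eps20.
case.
- by move=> p q b pq qb; rewrite /dual_rank h3// ?leeN2 ?lteN2.
- move=> p q b pq qb; rewrite /dual_rank fin_num_oppeD// -EFinN.
  by apply: h4; rewrite ?leeN2// EFinN lteN2.
move=> N [N1 [N2 N3] N4 N5 N6].
(* [flip] carries bars to bars of the dual and back; [slide] carries bars of [F] to bars of its
   shift by [eps]. *)
pose flip (u : (\bar R * \bar R) * nat) := ((- u.1.2, - u.1.1), u.2).
pose slide (u : (\bar R * \bar R) * nat) := ((u.1.1 + (- eps)%:E, u.1.2 + (- eps)%:E), u.2).
have flipK u : flip (flip u) = u by case: u => [[x y] c]; rewrite /flip/= !oppeK.
pose slide' (u : (\bar R * \bar R) * nat) := ((u.1.1 + eps%:E, u.1.2 + eps%:E), u.2).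
have slide'K u : slide (slide' u) = u.
  by case: u => [[x y] c]; rewrite /slide/slide'/= EFinN !addeK.
have slide_inj u v : slide u = slide v -> u = v.
  move=> /(congr1 slide'); case: u v => [[x y] c] [[x' y'] c'].
  by rewrite /slide'/slide/= !adde_EFinNK.
have copiesI u : copies (diagram (dual_rank I)) (flip u) = copies (diagram I) u.
  by case: u => [[x y] c]; rewrite /copies/= diagram_dual.
have copiesF u : copies (diagram (dual_rank (shift_rank eps F))) (flip (slide u)) =
    copies (diagram F) u.
  by case: u => [[x y] c]; rewrite /copies/= diagram_dual diagram_shift !adde_EFinNK.
exists [set uv | exists w, M (uv.1, w) /\ N (flip (slide uv.2), flip w)]; split.
- move=> [u v] [w [/M1[/= Eu _] /N1[/= + _]]]; split=> //=.
  by rewrite -copiesF.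
- split=> [u v v'|u u' v] [w /= [uw wv]] [w' /= [uw' wv']].
    apply/slide_inj; rewrite -[LHS]flipK -[RHS]flipK; congr flip.
    by apply: N3 wv _; rewrite (M2 _ _ _ uw uw').
  apply: M3 uw _; suff -> : w = w' by [].
  by rewrite -[LHS]flipK -[RHS]flipK; congr flip; exact: N2 wv wv'.
(* Through the intermediate bar [(x1, y1)]: [x1 = x] and [y1 <= y <= y1 + 2 eps], while
   [y1 = y' - eps] and [x1 - 2 eps <= x' - eps <= x1]. The shift by [eps] centres both errors,
   leaving at most [eps] in each coordinate. *)
- move=> [[x y] c] [[x' y'] c'] [[[x1 y1] c1] /= [/M4/= [<- H1 H2] /N4/= [/oppe_inj H3 H4 H5]]].
  split; rewrite /=.
    move: H4 H5 {H1 H2 H3}; case: x x' => [x| |] [x'| |]//=; rewrite -?EFinD ?lee_fin => H4 H5.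
    all: try by move: H4 H5; rewrite ?leye_eq ?leeNy_eq.
    by rewrite ler_norml; apply/andP; split; lra.
  rewrite -{}H3 in H1 H2; move: H1 H2 {H4 H5}.
  case: y y' => [y| |] [y'| |]//=; rewrite -?EFinD ?lee_fin => H1 H2.
  all: try by move: H1 H2; rewrite ?leye_eq ?leeNy_eq.
  by rewrite ler_norml; apply/andP; split; lra.
(* A bar of [E] longer than [2 eps] has a partner in [I], and every bar of [I] has one in [F]. The
   next case is symmetric. *)
- move=> u cu nM; apply: near_diagonal_le; first exact: diagram_lt cu.
  rewrite leNgt; apply/negP => /(M6 _ cu)[w uw]; apply: nM.
  have /N5[v vw] : copies (diagram (dual_rank I)) (flip w).
    by rewrite copiesI; case/M1: uw.
  exists (slide' (flip v)), w; split=> //=; rewrite slide'K flipK//.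
- move=> v cv nM; apply: near_diagonal_le; first exact: diagram_lt cv.
  rewrite leNgt; apply/negP => vlt; apply: nM.
  have [] := N6 (flip (slide v)).
  + by rewrite copiesF.
  + case: v vlt {cv} => [[[x| |] [y| |]] c]//=; rewrite -?EFinD ?lte_fin//.
    - by move=> ?; lra.
    - by rewrite ltNyr.
    - by rewrite ltry.
  move=> w vw.
  have [|u uw] := M5 (flip w).
    by rewrite -copiesI flipK; case/N1: vw.
  by exists u, (flip w); rewrite flipK.
Qed.

End RankFunctions.

(** * Finite ranks *)

Section Ranks.
Variable k : fieldType.
Implicit Types (U V W : lmodType k).

Definition indep W n (e : 'I_n -> W) :=
  forall c : 'I_n -> k, \sum_i c i *: e i = 0 -> forall i, c i = 0.

Definition lin_comb W n (c : 'I_n -> k) (e : 'I_n -> W) : W := \sum_i c i *: e i.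

Lemma lin_comb_mx W m n (c : 'I_m -> k) (M : 'M[k]_(m, n)) (g : 'I_n -> W) :
  \sum_i c i *: (\sum_j M i j *: g j) =
  \sum_j ((\row_i c i) *m M) 0 j *: g j.
Proof.
under eq_bigr do rewrite scaler_sumr.
rewrite exchange_big/=; apply: eq_bigr => j _; rewrite mxE scaler_suml.
by apply: eq_bigr => i _; rewrite scalerA mxE.
Qed.

Lemma indep_row_free W m n (e : 'I_m -> W) (M : 'M[k]_(m, n)) (g : 'I_n -> W) :
  indep e -> (forall i, e i = \sum_j M i j *: g j) -> row_free M.
Proof.
move=> ie eM; apply: inj_row_free => v vM.
apply/rowP => i; rewrite mxE; apply: ie i.
under eq_bigr do rewrite eM; rewrite lin_comb_mx big1// => j _.
by rewrite (_ : \row_i _ = v) ?vM ?mxE ?scale0r//; apply/rowP => i; rewrite mxE.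
Qed.

(** Steinitz: the coordinate matrix of [e] in terms of [g] has independent rows, hence at most as
    many rows as columns. *)
Lemma indep_leq W m n (e : 'I_m -> W) (g : 'I_n -> W) : indep e ->
  (forall i, exists c : 'I_n -> k, e i = \sum_j c j *: g j) -> (m <= n)%N.
Proof.
move=> ie /choice[M eM].
have := @indep_row_free _ _ _ e (\matrix_(i, j) M i j) g ie.
rewrite /row_free => H; rewrite -(eqP (H _)) ?rank_leq_col// => i.
by rewrite eM; apply: eq_bigr => j _; rewrite mxE.
Qed.

Lemma has_rank_leq U V (f : {linear U -> V}) n m (e : 'I_m -> V) :
  has_rank f n -> indep e -> (forall i, range f (e i)) -> (m <= n)%N.
Proof. by move=> [g [_ _ gS]] ie er; apply: (@indep_leq _ _ _ e g) => // i; exact: gS. Qed.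

Lemma rankE U V (f : {linear U -> V}) n : has_rank f n -> rank f = n.
Proof.
move=> fn; have fr := xgetPex 0%N (ex_intro _ n fn : [set n | has_rank f n] !=set0).
have [e [er ei _]] := fn; have [g [gr gi _]] := fr.
by apply/eqP; rewrite eqn_leq (has_rank_leq fn gi gr) (has_rank_leq fr ei er).
Qed.

(** An independent family of greatest length in the range spans it: a vector outside its span could
    be adjoined. *)
Lemma has_rank_ex U V (f : {linear U -> V}) N :
  (forall m (e : 'I_m -> V), indep e -> (forall i, range f (e i)) -> (m <= N)%N) ->
  exists n, has_rank f n.
Proof.
move=> fN; pose P m := `[< exists e : 'I_m -> V, indep e /\ forall i, range f (e i) >].
have Pex : exists m, P m.
  by exists 0%N; apply/asboolP; exists (fun=> 0); split; [move=> c _ []|case].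
have PN m : P m -> (m <= N)%N by move=> /asboolP[e [ei er]]; exact: fN er.
case: (ex_maxnP Pex PN) => n /asboolP[e [ei er]] nmax.
exists n, e; split=> // v rv.
pose e' (i : 'I_n.+1) := oapp e v (unlift ord0 i).
have e'0 : e' ord0 = v by rewrite /e' unlift_none.
have e'S i : e' (lift ord0 i) = e i by rewrite /e' liftK.
apply: contrapT => nspan; suff : (n.+1 <= n)%N by rewrite ltnn.
apply: nmax; apply/asboolP; exists e'; split; last first.
  by move=> i; case: (unliftP ord0 i) => [j|] ->; rewrite ?e'0 ?e'S.
move=> c; rewrite big_ord_recl e'0; under eq_bigr do rewrite e'S.
move=> cv; have c0 : c ord0 = 0.
  apply: contrapT => /eqP c0; apply: nspan.
  exists (fun i => - (c ord0)^-1 * c (lift ord0 i)).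
  under eq_bigr do rewrite -scalerA; rewrite -scaler_sumr.
  rewrite -[X in _ *: X](addKr (c ord0 *: v)) cv addr0 scalerN scaleNr opprK.
  by rewrite scalerA mulVf// scale1r.
move: cv; rewrite c0 scale0r add0r => /(ei (fun i => c (lift ord0 i))) cS i.
by case: (unliftP ord0 i) => [j|] ->.
Qed.

Lemma rank_compr U V W (A : {linear U -> V}) (B : {linear V -> W}) (f : {linear U -> W}) :
  (forall x, f x = B (A x)) -> (exists n, has_rank B n) ->
  (exists n, has_rank f n) /\ (rank f <= rank B)%N.
Proof.
move=> fE [n Bn]; have rfB v : range f v -> range B v.
  by move=> [x _ <-]; exists (A x) => //; rewrite fE.
have [|m fm] := @has_rank_ex _ _ f n.
  by move=> m e ie er; apply: (has_rank_leq Bn ie) => i; exact: rfB.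
split; first by exists m.
rewrite (rankE fm) (rankE Bn); have [e [er ie _]] := fm.
by apply: (has_rank_leq Bn ie) => i; exact: rfB.
Qed.

Lemma indep_preim U V (f : {linear U -> V}) n (e : 'I_n -> U) :
  indep (fun i => f (e i)) -> indep e.
Proof.
move=> ife c ce; apply: (ife c).
under eq_bigr do rewrite -linearZ/=.
by rewrite -linear_sum/= ce linear0.
Qed.

(** Preimages under [C] of independent vectors are independent, so a family in the range of [g]
    lifts to one in the range of [B]. *)
Lemma rank_compl U V W (B : {linear U -> V}) (C : {linear V -> W}) (g : {linear U -> W}) :
  (forall x, g x = C (B x)) -> (exists n, has_rank B n) ->
  (exists n, has_rank g n) /\ (rank g <= rank B)%N.
Proof.
move=> gE [n Bn].
have gB m (e : 'I_m -> W) : indep e -> (forall i, range g (e i)) -> (m <= n)%N.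
  move=> ie er; have /choice[x xE] : forall i, exists x, g x = e i.
    by move=> i; have [x _ <-] := er i; exists x.
  apply: (@has_rank_leq _ _ B n m (fun i => B (x i)) Bn) => [|i]; last by exists (x i).
  apply: (@indep_preim _ _ C); rewrite (_ : (fun i => _) = e)//.
  by apply/funext => i; rewrite -gE xE.
have [m gm] := has_rank_ex gB; split; first by exists m.
by rewrite (rankE gm) (rankE Bn); have [e [er ie _]] := gm; exact: gB er.
Qed.

(** A basis of the range of [f = BA] is extended, inside the range of [B], by lifts of a basis of a
    complement of the range of [h = CBA] in the range of [g = CB]. There are [rg - rh] such
    lifts. *)
Lemma frobenius V1 V2 V3 V4 (A : {linear V1 -> V2}) (B : {linear V2 -> V3})
    (C : {linear V3 -> V4}) (f : {linear V1 -> V3}) (g : {linear V2 -> V4})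
    (h : {linear V1 -> V4}) :
  (forall x, f x = B (A x)) -> (forall x, g x = C (B x)) -> (forall x, h x = C (f x)) ->
  (exists n, has_rank B n) -> (rank f + rank g <= rank B + rank h)%N.
Proof.
move=> fE gE hE Bfin.
have [ffin _] := rank_compr fE Bfin; have [gfin _] := rank_compl gE Bfin.
have [hfin hf] := rank_compl hE ffin.
case: Bfin ffin gfin hfin => [rB HB] [rf Hf] [rg Hg] [rh Hh].
rewrite (rankE HB) (rankE Hf) (rankE Hg) (rankE Hh).
have [p [pr ip _]] := Hf; have [u [ur iu us]] := Hg; have [w [wr iw ws]] := Hh.
have hg v : range h v -> range g v.
  by move=> [x _ <-]; exists (A x) => //; rewrite gE hE fE.
have /choice[M wM] : forall i, exists c : 'I_rg -> k, w i = \sum_j c j *: u j.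
  by move=> i; apply/us/hg.
pose M' := \matrix_(i, j) M i j.
have wM' i : w i = \sum_j M' i j *: u j by rewrite wM; apply: eq_bigr => j _; rewrite mxE.
have Mfree : row_free M' by exact: indep_row_free wM'.
(* The rows of [M'] are the coordinates of [w] in the basis [u]; the rows of [N] span a complement,
   and [t] lists the corresponding vectors. *)
pose N := row_base (M'^C)%MS; pose d : nat := \rank (M'^C)%MS.
have dE : (d + rh)%N = rg.
  by rewrite /d mxrank_compl (eqP Mfree) subnK// -(eqP Mfree) rank_leq_col.
pose t i := \sum_j N i j *: u j.
have /choice[x xt] : forall i, exists x, g x = t i.
  have /choice[y yu] : forall j, exists y, g y = u j.
    by move=> j; have [y _ <-] := ur j; exists y.
  move=> i; exists (\sum_j N i j *: y j); rewrite linear_sum.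
  by apply: eq_bigr => j _; rewrite linearZ/= yu.
have /choice[y yp] : forall j, exists y, f y = p j.
  by move=> j; have [y _ <-] := pr j; exists y.
pose q (i : 'I_(rf + d)%N) := match fintype.split i with inl j => p j | inr j => B (x j) end.
suff : (rf + d <= rB)%N by lia.
apply: (has_rank_leq HB (e := q)); last first.
  move=> i; rewrite /q; case: (fintype.split i) => j; last by exists (x j).
  by exists (A (y j)) => //; rewrite -fE yp.
move=> c; rewrite big_split_ord/= /q.
under eq_bigr do rewrite (unsplitK (inl _)).
under [X in _ + X]eq_bigr do rewrite (unsplitK (inr _)).
set a := fun i => c (lshift d i); set b := fun i => c (rshift rf i).
rewrite -/(lin_comb a p) -/(lin_comb b (fun i => B (x i))) => ab0.
(* Applying [C] to the relation puts the combination of the [t i] into the range of [h]. The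
   complement meets that range only in 0, so these coefficients vanish, and independence of [p]
   settles the others. *)
have b0 i : b i = 0.
  have : \sum_i b i *: t i = - h (\sum_i a i *: y i).
    apply/eqP; rewrite -addr_eq0; apply/eqP; rewrite -[RHS](linear0 C) -ab0 addrC linearD/=.
    rewrite /lin_comb !linear_sum; congr (_ + _); apply: eq_bigr => j _.
      by rewrite linearZ/= -gE xt.
    by rewrite !linearZ/= hE yp.
  have [e ->] := ws (h (\sum_i a i *: y i)) (imageT _ _).
  under [X in - X]eq_bigr do rewrite wM'; rewrite /t !lin_comb_mx.
  set bN := _ *m N; set eM := _ *m M' => be.
  have {}be : bN = - eM.
    apply/rowP => j; rewrite [RHS]mxE; apply/eqP; rewrite -addr_eq0; apply/eqP.
    apply: (iu (fun j => bN 0 j + eM 0 j)).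
    under eq_bigr do rewrite scalerDl.
    by rewrite big_split/= be addNr.
  have bN0 : bN = 0.
    apply/eqP; rewrite -submx0 -(capmx_compl M') sub_capmx {1}be.
    by rewrite eqmx_opp submxMl/= (submx_trans (submxMl _ _))// eq_row_base.
  have /row_free_inj/(_ (\row_i b i) 0) : row_free N by exact: row_base_free.
  by rewrite mul0mx => /(_ bN0)/rowP/(_ i); rewrite !mxE.
move=> i; case: (fintype.splitP i) => j ij.
  have -> : i = lshift d j by exact/val_inj.
  apply: (ip a); move: ab0; rewrite /lin_comb [X in _ + X]big1 ?addr0// => l _.
  by rewrite b0 scale0r.
have -> : i = rshift rf j by exact/val_inj.
exact: b0.
Qed.

End Ranks.

(** * Chains, cones and chain maps *)

Section Chains.
Variable k : fieldType.

Section OneVertexType.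
Variable T : choiceType.
Implicit Types (s t : {fset T}) (v w : T).

Local Notation chains := (malg {fset T} k).

Definition simplex s : chains := mkmalgU s 1.

Lemma simplexZ s a : mkmalgU s a = a *: simplex s :> chains.
Proof. by apply/malgP => t; rewrite mcoeffZ !mcoeffU mulrnAr mulr1. Qed.

Definition chain_on (P : set {fset T}) (c : chains) := forall s, s \in msupp c -> P s.

Lemma chain_on0 P : chain_on P 0.
Proof. by move=> s; rewrite msupp0. Qed.

Lemma chain_onD P c d : chain_on P c -> chain_on P d -> chain_on P (c + d).
Proof.
by move=> Pc Pd s /(fsubsetP (msuppD_le _ _)); rewrite inE => /orP[/Pc|/Pd].
Qed.

Lemma chain_onZ P a c : chain_on P c -> chain_on P (a *: c).
Proof. by move=> Pc s /(fsubsetP (msuppZ_le _ _))/Pc. Qed.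

Lemma chain_onB P c d : chain_on P c -> chain_on P d -> chain_on P (c - d).
Proof. by move=> Pc Pd; apply: chain_onD => //; rewrite -scaleN1r; exact: chain_onZ. Qed.

Lemma chain_on_sum P (I : eqType) (r : seq I) (F : I -> chains) :
  (forall i, i \in r -> chain_on P (F i)) -> chain_on P (\sum_(i <- r) F i).
Proof.
move=> PF; rewrite big_seq; apply: big_ind => //; first exact: chain_on0.
exact: chain_onD.
Qed.

Lemma chain_on_simplex P s : P s -> chain_on P (simplex s).
Proof. by move=> Ps t; rewrite msuppU oner_eq0 inE => /eqP->. Qed.

Lemma chain_onS P Q c : P `<=` Q -> chain_on P c -> chain_on Q c.
Proof. by move=> PQ Pc s /Pc/PQ. Qed.

Section LinearExtension.
Variable V : lmodType k.

Definition linext (F : {fset T} -> V) (c : chains) : V :=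
  \sum_(s <- msupp c) mcoeff s c *: F s.

Lemma linextEw F (D : {fset {fset T}}) c : (msupp c `<=` D)%fset ->
  linext F c = \sum_(s <- D) mcoeff s c *: F s.
Proof.
by move=> cD; apply: big_fset_incl => // s _ /mcoeff_outdom->; exact: scale0r.
Qed.

Fact linext_linear F : linear (linext F).
Proof.
move=> a c d; pose D := (msupp (a *: c + d) `|` (msupp c `|` msupp d))%fset.
rewrite !(@linextEw F D) ?fsubsetUl//; last 2 first.
- by rewrite fsubsetU// fsubsetUr orbT.
- by rewrite fsubsetU// fsubsetUl orbT.
rewrite scaler_sumr -big_split/=; apply: eq_bigr => s _.
by rewrite scalerA -scalerDl mcoeffD mcoeffZ.
Qed.

HB.instance Definition _ F := GRing.isLinear.Build k chains V *:%R
  (linext F) (linext_linear F).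

Lemma linextU F s : linext F (simplex s) = F s.
Proof.
rewrite (@linextEw F [fset s]%fset) ?msuppU; last by case: eqP.
by rewrite big_seq_fset1 mcoeffUU scale1r.
Qed.

Lemma linear_linext (f : {linear chains -> V}) c : f c = linext (fun s => f (simplex s)) c.
Proof.
rewrite [in LHS](monalgE c) linear_sum; apply: eq_bigr => s _.
by rewrite simplexZ linearZ.
Qed.

Lemma eq_linear_on (P : set {fset T}) (f g : {linear chains -> V}) c : chain_on P c ->
  (forall s, P s -> f (simplex s) = g (simplex s)) -> f c = g c.
Proof.
move=> Pc fg; rewrite linear_linext [RHS]linear_linext /linext !big_seq.
by apply: eq_bigr => s /Pc/fg ->.
Qed.

Lemma eq_linear (f g : {linear chains -> V}) :
  (forall s, f (simplex s) = g (simplex s)) -> f =1 g.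
Proof. by move=> fg c; apply: (@eq_linear_on setT). Qed.

End LinearExtension.

Definition pos s v := #|` [fset w in s | vertex_lt w v]%fset|.

Definition rface s : chains := \sum_(v <- s) (-1) ^+ pos s v *: simplex (s `\ v)%fset.

(* Unlike [boundary], the reduced boundary sends a vertex to the empty simplex. *)
Definition rboundary : {linear chains -> chains} := linext rface.

(** The simplex with [v] placed in front; the sign comes from moving [v] to its place in the vertex
    order. *)
Definition cone v : {linear chains -> chains} :=
  linext (fun s => if v \in s then 0 else (-1) ^+ pos s v *: simplex (v |` s)%fset).

Lemma rboundaryU s : rboundary (simplex s) = rface s.
Proof. exact: linextU. Qed.

Lemma coneU v s : cone v (simplex s) =
  if v \in s then 0 else (-1) ^+ pos s v *: simplex (v |` s)%fset.
Proof. exact: linextU. Qed.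

Lemma vertex_lt_irr v : vertex_lt v v = false.
Proof. by rewrite /vertex_lt eqxx andbF. Qed.

Lemma posD1 s v w : w \in s -> pos s v = (pos (s `\ w)%fset v + vertex_lt w v)%N.
Proof.
move=> ws; rewrite /pos (cardfsD1 w) !inE ws/= addnC; congr (#|` _| + _)%N.
by apply/fsetP => u; rewrite !inE andbA.
Qed.

Lemma sqr_sign_pos (n : nat) : (-1) ^+ n * (-1) ^+ n = 1 :> k.
Proof. by rewrite -exprD addnn -mul2n exprM sqrrN !expr1n. Qed.

(** The cone is a contracting homotopy of the augmented complex. If [v] is in [s], only the face
    opposite to [v] survives; otherwise all terms but [s] cancel in pairs. *)
Lemma cone_rboundaryU v s :
  rboundary (cone v (simplex s)) + cone v (rboundary (simplex s)) = simplex s.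
Proof.
rewrite rboundaryU coneU; case: ifPn => vs.
  rewrite linear0 add0r linear_sum (big_fsetD1 v vs)/= big_seq big1 ?addr0.
    rewrite linearZ/= coneU !inE eqxx/= fsetD1K// scalerA (posD1 v vs).
    by rewrite vertex_lt_irr addn0 sqr_sign_pos scale1r.
  move=> w; rewrite !inE => /andP[wv ws].
  by rewrite linearZ/= coneU !inE eq_sym wv vs/= scaler0.
rewrite linearZ/= rboundaryU /rface big_fsetU1//= scalerDr fsetU1K//.
have posv : pos (v |` s)%fset v = pos s v.
  by rewrite (posD1 v (fset1U1 _ _)) fsetU1K// vertex_lt_irr addn0.
rewrite posv scalerA sqr_sign_pos scale1r -addrA -[RHS]addr0; congr (_ + _).
rewrite scaler_sumr linear_sum -big_split/= big_seq big1// => w ws.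
have wv : w != v by apply: contraNneq vs => <-.
rewrite [X in _ + X]linearZ/= coneU !inE (negbTE vs) andbF/= !scalerA.
have -> : ((v |` s) `\ w = v |` (s `\ w))%fset.
  by apply/fsetP => u; rewrite !inE; case: eqP => // ->; rewrite (negbTE wv).
rewrite -scalerDl -!exprD (posD1 v ws).
rewrite (@posD1 (v |` s)%fset w v) ?fset1U1// fsetU1K//.
(* Exactly one of [v], [w] precedes the other, so the exponents of the two signs differ by one. *)
have := vertex_lt_neg wv; case: (vertex_lt v w) => /= vw.
  rewrite (_ : vertex_lt w v = false); last by case: vertex_lt vw.
  by rewrite addn0 addn1 addnS exprS mulN1r addnC addNr scale0r.
rewrite (_ : vertex_lt w v = true); last by case: vertex_lt vw.
by rewrite addn0 addn1 addSn exprS mulN1r addnC addNr scale0r.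
Qed.

Lemma cone_rboundary v c : rboundary (cone v c) = c - cone v (rboundary c).
Proof.
apply/eqP; rewrite eq_sym subr_eq eq_sym; apply/eqP.
exact: (@eq_linear _ ((rboundary \o cone v) \+ (cone v \o rboundary))%R idfun (cone_rboundaryU v)).
Qed.

Lemma cone_chain_on v (P Q : set {fset T}) c : chain_on P c ->
  (forall s, P s -> Q (v |` s)%fset) -> chain_on Q (cone v c).
Proof.
move=> Pc PQ; apply: chain_on_sum => s sc; apply: chain_onZ; case: ifP => _.
  exact: chain_on0.
by apply: chain_onZ; apply: chain_on_simplex; apply: PQ; exact: Pc.
Qed.

Lemma rface_chain_on s : chain_on [set t | exists2 v, v \in s & t = (s `\ v)%fset] (rface s).
Proof.
apply: chain_on_sum => v vs; apply: chain_onZ; apply: chain_on_simplex.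
by exists v.
Qed.

Lemma rboundary0 : rboundary (simplex fset0) = 0.
Proof. by rewrite rboundaryU /rface big_seq_fset0. Qed.

(** A nonempty simplex is, up to sign, a cone over a smaller one, and the cone formula reduces the
    claim to that smaller simplex. *)
Lemma rboundaryK c : rboundary (rboundary c) = 0.
Proof.
suff H s : rboundary (rboundary (simplex s)) = 0.
  exact: (@eq_linear _ (rboundary \o rboundary)%R \0%R H).
have [n] := ubnP #|` s|; elim: n s => // n IH s sn.
have [->|[v vs]] := fset_0Vmem s; first by rewrite rboundary0 linear0.
have -> : simplex s = (-1) ^+ pos s v *: cone v (simplex (s `\ v)%fset).
  rewrite coneU !inE eqxx/= fsetD1K// scalerA (posD1 v vs) vertex_lt_irr addn0.
  by rewrite sqr_sign_pos scale1r.
rewrite !linearZ/= cone_rboundary linearB/= cone_rboundary IH ?linear0 ?subr0.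
  by rewrite ?addr0 subrr scaler0.
by move: sn; rewrite (cardfsD1 v) vs.
Qed.

(** Allows a map to be defined on a simplex from its values on the faces. The recursion uses the
    number of vertices as fuel, which runs out only at the empty simplex, whose [rface] is 0. *)
Lemma chain_rec (V : lmodType k) (G : {fset T} -> V -> V) :
  exists H : {fset T} -> V, forall s, H s = G s (linext H (rface s)).
Proof.
pose fix H (n : nat) (s : {fset T}) {struct n} : V :=
  if n is n'.+1 then G s (linext (H n') (rface s)) else G s 0.
exists (fun s => H #|` s| s) => s.
case sn : #|` s| => [|n] /=; last first.
  congr G; apply: eq_big_seq => t /rface_chain_on[v vs ->].
  by move: sn; rewrite (cardfsD1 v) vs add1n => -[->].
move/eqP: sn; rewrite cardfs_eq0 => /eqP ->.
by rewrite /rface big_seq_fset0 linear0.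
Qed.

(** The two boundaries differ only on vertices; [a] is the augmentation of [c]. *)
Lemma boundary_rboundary c : chain_on [set s | s != fset0] c ->
  exists a, rboundary c = boundary c + a *: simplex fset0.
Proof.
move=> c0; exists (\sum_(s <- msupp c) mcoeff s c * (#|` s| == 1)%:R).
rewrite scaler_suml -[rboundary c]/(linext rface c) /linext /boundary -big_split/=.
rewrite !big_seq; apply: eq_bigr => s sc.
rewrite -scalerA -scalerDr; congr (_ *: _); rewrite /simplex_boundary /rface.
have s0 := c0 _ sc; have [s1|s1] := leqP #|` s| 1; last first.
  rewrite gtn_eqF// scale0r addr0; apply: eq_bigr => v _.
  by rewrite [RHS]simplexZ.
have /cardfs1P[v ->] : #|` s| == 1 by rewrite eqn_leq s1 cardfs_gt0.
rewrite cardfs1 scale1r add0r big_seq_fset1.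
rewrite (_ : pos _ v = 0%N); last first.
  apply/eqP; rewrite cardfs_eq0; apply/eqP/fsetP => u.
  by rewrite !inE; case: eqP => // ->; rewrite vertex_lt_irr.
by rewrite scale1r fsetDv.
Qed.

Lemma boundary_chain_on c : chain_on [set s | s != fset0] (boundary c).
Proof.
apply: chain_on_sum => s _; apply: chain_onZ; rewrite /simplex_boundary.
case: leqP => s1; first exact: chain_on0.
apply: chain_on_sum => v vs; rewrite simplexZ.
apply: chain_onZ; apply: chain_on_simplex => /=.
by rewrite -cardfs_gt0; move: s1; rewrite (cardfsD1 v) vs.
Qed.

Lemma mcoeff0_linear (c d : chains) a :
  mcoeff fset0 (c + a *: d) = mcoeff fset0 c + a * mcoeff fset0 d.
Proof. by rewrite mcoeffD mcoeffZ. Qed.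

Lemma mcoeff0_simplex : mcoeff fset0 (simplex fset0) = 1.
Proof. exact: mcoeffUU. Qed.

Lemma mcoeff0_chain_on c : chain_on [set s | s != fset0] c -> mcoeff fset0 c = 0.
Proof.
move=> c0; apply: mcoeff_outdom; apply/negP => sc.
have : fset0 != fset0 :> {fset T} := c0 _ sc.
by rewrite eqxx.
Qed.

Lemma add_simplex0_inj (c d : chains) a b :
  chain_on [set s | s != fset0] c -> chain_on [set s | s != fset0] d ->
  c + b *: simplex fset0 = d + a *: simplex fset0 -> c = d.
Proof.
move=> c0 d0 cd.
have E e e' : chain_on [set s | s != fset0] e -> mcoeff fset0 (e + e' *: simplex fset0) = e'.
  by move=> e0; rewrite (mcoeff0_linear e (simplex fset0) e') mcoeff0_simplex
    (mcoeff0_chain_on e0) mulr1 add0r.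
have ab : b = a by rewrite -(E c b c0) cd (E d a d0).
by move: cd; rewrite ab => /addIr.
Qed.

(** Identities are proved for the reduced boundary, where cones behave uniformly, and brought back
    by dropping the multiple of the empty simplex. *)
Lemma boundaryE c d a : chain_on [set s | s != fset0] c -> chain_on [set s | s != fset0] d ->
  rboundary c = d + a *: simplex fset0 -> boundary c = d.
Proof.
move=> c0 d0; have [b ->] := boundary_rboundary c0.
by apply: add_simplex0_inj => //; exact: boundary_chain_on.
Qed.

End OneVertexType.

End Chains.

Arguments simplex {k T} s.
Arguments rface {k T} s.
Arguments rboundary {k T}.
Arguments cone {k T} v.

(** * Augmented chain maps, acyclic carriers and homotopies *)

Section ChainMapsAndHomotopies.
Variable k : fieldType.

Section ChainMaps.
Variables X Y : choiceType.

Local Notation chains T := (malg {fset T} k).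

Lemma linext_chain_on (P : set {fset X}) (Q : set {fset Y}) (F : {fset X} -> chains Y) c :
  chain_on P c -> (forall s, P s -> chain_on Q (F s)) -> chain_on Q (linext F c).
Proof.
by move=> Pc PF; apply: chain_on_sum => s sc; apply: chain_onZ; apply: PF; exact: Pc.
Qed.

Lemma linear_chain_on (P : set {fset X}) (Q : set {fset Y})
    (f : {linear chains X -> chains Y}) c :
  chain_on P c -> (forall s, P s -> chain_on Q (f (simplex s))) -> chain_on Q (f c).
Proof. by move=> Pc Pf; rewrite linear_linext; exact: linext_chain_on Pf. Qed.

Definition faces_of (D : {fset Y}) : set {fset Y} :=
  [set t | t != fset0 /\ (t `<=` D)%fset].

(* Both conditions together say that [f] is an augmented chain map. *)
Definition chain_map (f : {linear chains X -> chains Y}) :=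
  (forall c, rboundary (f c) = f (rboundary c)) /\ f (simplex fset0) = simplex fset0.

(** An acyclic carrier: the image of [s] lies in the full simplex on [D s], where cones are
    available. *)
Definition carried (D : {fset X} -> {fset Y}) (f : {linear chains X -> chains Y}) :=
  forall s, s != fset0 -> chain_on (faces_of (D s)) (f (simplex s)).

Lemma carried_is_chain (K : simplicial_complex X) (L : simplicial_complex Y) D f c :
  carried D f -> (forall s, simplices K s -> simplices L (D s)) ->
  is_chain K c -> is_chain L (f c).
Proof.
move=> fD DL Kc; apply: (linear_chain_on (P := simplices K)) => // s Ks.
apply: chain_onS (fD s (simplices_neq0 Ks)) => t [t0 tD].
exact: simplices_sub (DL _ Ks) tD t0.
Qed.

Lemma carried_neq0 D f c : carried D f ->
  chain_on [set s | s != fset0] c -> chain_on [set s | s != fset0] (f c).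
Proof.
move=> fD c0; apply: (linear_chain_on c0) => s s0.
by apply: chain_onS (fD s s0) => t [].
Qed.

Lemma chain_map_boundary D f c : chain_map f -> carried D f ->
  chain_on [set s | s != fset0] c -> boundary (f c) = f (boundary c).
Proof.
move=> [fb f0] fD c0; have [a ca] := boundary_rboundary c0.
apply: (boundaryE (a := a)); first exact: carried_neq0 fD _.
  by apply: carried_neq0 fD _; exact: boundary_chain_on.
by rewrite fb ca linearD linearZ/= f0.
Qed.

Lemma faces_neq0 T (K : simplicial_complex T) (c : chains T) : is_chain K c ->
  chain_on [set s | s != fset0] c.
Proof. by move=> Kc s /Kc/simplices_neq0. Qed.

End ChainMaps.

Lemma ohead_fset (T : choiceType) (s : {fset T}) : s != fset0 ->
  exists2 x, x \in s & ohead s = Some x.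
Proof.
move=> s0; case E : (ohead s) => [x|].
  exists x => //; move: E; rewrite -[x \in s]/(x \in enum_fset s).
  by case: (enum_fset s) => //= y r [->]; rewrite mem_head.
have [x xs] := fset0Pn _ s0.
by move: E xs; rewrite -[x \in s]/(x \in enum_fset s); case: (enum_fset s).
Qed.

(* The image of a simplex is the cone from one of its vertices over the image
   of its boundary. *)
Lemma pushforward (X Y : choiceType) (phi : X -> Y) :
  exists f : {linear malg {fset X} k -> malg {fset Y} k},
    chain_map f /\ carried (fun s => [fset phi x | x in s]%fset) f.
Proof.
have [H HE] := chain_rec (fun (s : {fset X}) (c : malg {fset Y} k) =>
  if ohead s is Some x then cone (phi x) c else simplex fset0).
have H0 : H fset0 = simplex fset0 by rewrite HE.
have faces s : chain_on [set t | (#|` t| < #|` s|)%N /\ (t `<=` s)%fset] (@rface k X s).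
  apply: chain_onS (@rface_chain_on k X s) => t [v vs ->].
  by rewrite /= [X in (_ < X)%N](cardfsD1 v) vs add1n ltnS fsubD1set.
have Hb s : rboundary (H s) = linext H (rface s).
  have [n] := ubnP #|` s|; elim: n s => // n IH s sn.
  have [->|s0] := eqVneq s fset0.
    by rewrite H0 rboundary0 /rface big_seq_fset0 linear0.
  have [x _ sx] := ohead_fset s0.
  rewrite HE sx cone_rboundary.
  (* By induction [linext H] commutes with the boundary on smaller simplices, so the chain to be
     coned off is a cycle. *)
  suff -> : rboundary (linext H (rface s)) = 0 by rewrite linear0 subr0.
  rewrite -[RHS](linear0 (linext H)) -(rboundaryK (simplex s)) rboundaryU.
  apply: (@eq_linear_on k X _ _ (rboundary \o linext H)%R (linext H \o rboundary)%R _ (faces s)).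
  move=> t [ts _] /=; rewrite -!/(rboundary _) linextU IH ?rboundaryU//.
  exact: leq_trans ts _.
have HD (s : {fset X}) : chain_on [set t | (t `<=` [fset phi x | x in s])%fset] (H s) /\
    (s != fset0 -> chain_on (faces_of [fset phi x | x in s]%fset) (H s)).
  have [n] := ubnP #|` s|; elim: n s => // n IH s sn.
  have [->|s0] := eqVneq s fset0.
    by split=> //; rewrite H0; apply: chain_on_simplex => /=; exact: fsub0set.
  suff HDs : chain_on (faces_of [fset phi x | x in s]%fset) (H s).
    by split=> // ; apply: chain_onS HDs => t [].
  have [x xs sx] := ohead_fset s0; rewrite HE sx.
  apply: (@cone_chain_on k _ _ [set t | (t `<=` [fset phi x | x in s])%fset]); last first.
    move=> t /= tD; split; first by apply/fset0Pn; exists (phi x); rewrite fset1U1.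
    by rewrite fsubUset tD andbT fsub1set in_imfset.
  apply: (linext_chain_on (faces s)) => t [ts tsub].
  have [tD _] := IH t (leq_trans ts sn).
  apply: chain_onS tD => u /= ut; apply: fsubset_trans ut _.
  by apply: subset_imfset => x' /(fsubsetP tsub).
exists (linext H); split; last by move=> s s0; rewrite /= linextU; exact: (HD s).2.
split; last by rewrite /= linextU.
apply: (@eq_linear k X _ (rboundary \o linext H)%R (linext H \o rboundary)%R) => s /=.
by rewrite -!/(rboundary _) linextU Hb rboundaryU.
Qed.

(** The homotopy on [s] is the cone, from a vertex of [s], over [F s - s - h (rboundary s)], which
    is a cycle by induction. Since [D] is monotone and contains [s], that chain and its cone stay in
    the full simplex on [D s]. *)
Lemma chain_homotopy (X : choiceType) (D : {fset X} -> {fset X})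
    (F : {linear malg {fset X} k -> malg {fset X} k}) :
  (forall s, (s `<=` D s)%fset) -> (forall s t, (s `<=` t)%fset -> (D s `<=` D t)%fset) ->
  chain_map F -> carried D F ->
  exists h : {linear malg {fset X} k -> malg {fset X} k},
    [/\ forall c, rboundary (h c) = F c - c - h (rboundary c),
        h (simplex fset0) = 0 & carried D h].
Proof.
move=> sD Dmono [Fb F0] FD.
have [H HE] := chain_rec (fun (s : {fset X}) (c : malg {fset X} k) =>
  if ohead s is Some x then cone x (F (simplex s) - simplex s - c) else 0).
have H0 : H fset0 = 0 by rewrite HE.
have faces s : chain_on [set t | (#|` t| < #|` s|)%N /\ (t `<=` s)%fset] (@rface k X s).
  apply: chain_onS (@rface_chain_on k X s) => t [v vs ->].
  by rewrite /= [X in (_ < X)%N](cardfsD1 v) vs add1n ltnS fsubD1set.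
have Hb s : rboundary (H s) = F (simplex s) - simplex s - linext H (rface s).
  have [n] := ubnP #|` s|; elim: n s => // n IH s sn.
  have [->|s0] := eqVneq s fset0.
    by rewrite H0 F0 subrr /rface big_seq_fset0 !linear0 addr0.
  have [x _ sx] := ohead_fset s0.
  rewrite HE sx cone_rboundary.
  suff -> : rboundary (F (simplex s) - simplex s - linext H (rface s)) = 0.
    by rewrite linear0 subr0.
  rewrite !linearB/= -!/(rboundary _) Fb rboundaryU.
  apply/eqP; rewrite subr_eq0 eq_sym; apply/eqP.
  transitivity (F (rface s) - rface s - linext H (rboundary (rface s))); last first.
    by rewrite -(rboundaryU k s) rboundaryK linear0 subr0.
  apply: (@eq_linear_on k X _ _ (rboundary \o linext H)%R
    ((F \- idfun) \- (linext H \o rboundary))%R _ (faces s)).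
  move=> t [ts _] /=; rewrite -!/(rboundary _) linextU IH ?rboundaryU//.
  exact: leq_trans ts _.
have HD (s : {fset X}) : s != fset0 -> chain_on (faces_of (D s)) (H s).
  have [n] := ubnP #|` s|; elim: n s => // n IH s sn s0.
  have [x xs sx] := ohead_fset s0; rewrite HE sx.
  apply: (@cone_chain_on k _ _ [set t | (t `<=` D s)%fset]); last first.
    move=> t /= tD; split; first by apply/fset0Pn; exists x; rewrite fset1U1.
    by rewrite fsubUset tD andbT fsub1set (fsubsetP (sD s)).
  apply: chain_onB.
    apply: chain_onB; first by apply: chain_onS (FD s s0) => t [].
    by apply: chain_on_simplex; exact: sD.
  apply: (linext_chain_on (faces s)) => t [ts tsub].
  have [->|t0] := eqVneq t fset0; first by rewrite H0; exact: chain_on0.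
  apply: chain_onS (IH t (leq_trans ts sn) t0) => u [_ ut] /=.
  exact: fsubset_trans ut (Dmono _ _ tsub).
exists (linext H); split; last by move=> s s0; rewrite /= linextU; exact: HD.
- move=> c; apply: (@eq_linear k X _ (rboundary \o linext H)%R
    ((F \- idfun) \- (linext H \o rboundary))%R) => s /=.
  by rewrite -!/(rboundary _) linextU Hb rboundaryU.
- by rewrite /= linextU.
Qed.

(** For a cycle [c] the reduced boundary is a multiple of the empty simplex, which the homotopy [h]
    kills; hence [h c] bounds [F c - c]. *)
Lemma carried_homologous (X : choiceType) (K L : simplicial_complex X) D
    (F : {linear malg {fset X} k -> malg {fset X} k}) c :
  (forall s, (s `<=` D s)%fset) -> (forall s t, (s `<=` t)%fset -> (D s `<=` D t)%fset) ->
  chain_map F -> carried D F -> (forall s, simplices K s -> simplices L (D s)) ->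
  is_cycle K c -> exists2 d, is_chain L d & boundary d = F c - c.
Proof.
move=> sD Dmono Fc FD DL /asboolP[Kc c0].
have [h [hb h0 hD]] := chain_homotopy sD Dmono Fc FD.
have cn := faces_neq0 Kc.
exists (h c); first exact: carried_is_chain hD DL Kc.
apply: (boundaryE (a := 0)).
- exact: carried_neq0 hD cn.
- by apply: chain_onB => //; exact: carried_neq0 FD cn.
have [a ca] := boundary_rboundary cn.
by rewrite hb ca c0 add0r linearZ/= h0 scaler0 subr0 scale0r addr0.
Qed.

Section HomologyMap.
Variables (X Y : choiceType) (K : simplicial_complex X) (L : simplicial_complex Y).
Variables (f : {linear malg {fset X} k -> malg {fset Y} k}).
Hypothesis fKL : forall c, is_chain K c -> is_chain L (f c) /\ boundary (f c) = f (boundary c).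

Fact push_is_cycle c : is_cycle K c -> is_cycle L (f c).
Proof.
move=> /asboolP[/fKL[Lc fc] c0]; apply/asboolP; split=> //.
by rewrite fc c0 linear0.
Qed.

Definition push_cycle (z : Defs.cycle k K) : Defs.cycle k L := Cycle (push_is_cycle (valP z)).

Fact push_cycle_linear : linear push_cycle.
Proof. by move=> a z w; apply/val_inj; rewrite /= linearP. Qed.

HB.instance Definition _ := GRing.isLinear.Build k (Defs.cycle k K) (Defs.cycle k L) *:%R
  push_cycle push_cycle_linear.

Fact push_cycle_boundary z : z \in @is_boundary _ _ K -> push_cycle z \in @is_boundary _ _ L.
Proof.
move=> /asboolP[c /fKL[Lc fc] cz]; apply/asboolP; exists (f c) => //.
by rewrite fc cz.
Qed.

Definition homology_map : {linear homology k K -> homology k L} :=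
  quotmod_map push_cycle_boundary.

End HomologyMap.

End ChainMapsAndHomotopies.

(** * Algebraic stability *)

Section ExtendedReals.
Variable R : realType.
Implicit Types (x y : \bar R) (A : set (\bar R)).
Local Open Scope ereal_scope.

Lemma nbhs_ex_gt x A : x < +oo -> nbhs x A -> exists2 y, x < y & A y.
Proof.
case: x => [x| |]// _ xA.
  have /nbhs_ballP[e /= e0 {}xA] : nbhs x (fun r => A r%:E) by [].
  exists (x + e / 2)%:E.
    by rewrite lte_fin ltrDl divr_gt0.
  apply: (xA (x + e / 2)%R).
  rewrite /ball/= opprD addNKr normrN gtr0_norm ?divr_gt0//.
  by rewrite ltr_pdivrMr// ltr_pMr// ltr1n.
have [M [_ MA]] := xA; exists (M - 1)%:E; first exact: ltNyr.
by apply: MA; rewrite lte_fin ltrBlDr ltrDl.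
Qed.

Lemma nbhs_ex_lt x A : -oo < x -> nbhs x A -> exists2 y, y < x & A y.
Proof.
case: x => [x| |]// _ xA.
  have /nbhs_ballP[e /= e0 {}xA] : nbhs x (fun r => A r%:E) by [].
  exists (x - e / 2)%:E.
    by rewrite lte_fin ltrBlDr ltrDl divr_gt0.
  apply: (xA (x - e / 2)%R).
  rewrite /ball/= opprB addrC subrK gtr0_norm ?divr_gt0//.
  by rewrite ltr_pdivrMr// ltr_pMr// ltr1n.
have [M [_ MA]] := xA; exists (M + 1)%:E; first exact: ltry.
by apply: MA; rewrite lte_fin ltrDl.
Qed.

Lemma nbhs_lt_ereal x y : x < y -> nbhs x [set z | z <= y].
Proof.
case: x y => [x| |] [y| |]//= xy.
- apply/(nbhs_ballP x); exists (y - x)%R => /=; first by rewrite subr_gt0.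
  move=> z; rewrite /ball/= => xz; rewrite lee_fin.
  by have := ler_norm (z - x)%R; rewrite distrC; lra.
- by apply: filterE => z; exact: leey.
- by exists y; split=> [|z /ltW]; rewrite ?num_real.
- by exists 0%R; split=> [|z _]; [rewrite num_real|exact: leey].
Qed.

Lemma nbhs_gt_ereal x y : y < x -> nbhs x [set z | y <= z].
Proof.
case: x y => [x| |] [y| |]//= xy.
- apply/(nbhs_ballP x); exists (x - y)%R => /=; first by rewrite subr_gt0.
  move=> z; rewrite /ball/= => xz; rewrite lee_fin.
  by have := ler_norm (x - z)%R; lra.
- by apply: filterE => z; exact: leNye.
- by exists y; split=> [|z /ltW]; rewrite ?num_real.
- by exists 0%R; split=> [|z _]; [rewrite num_real|exact: leNye].
Qed.

(** Away from an infinite end, each neighbourhood contains points strictly on either side. At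
    [x = -oo] the rectangle must itself start at [-oo], and likewise at [y = +oo]. *)
Lemma interior_rectP (p q r s : \bar R) z : z.1 < z.2 -> p < q -> r < s ->
  ([set` `[p, q]] `*` [set` `[r, s]])° z <->
  [/\ lside z.1 p, z.1 < q, r < z.2 & rside z.2 s].
Proof.
case: z => x y /= xy pq rs; split.
  move=> [[A B] /= [xA yB] AB].
  have Ax := nbhs_singleton xA; have By := nbhs_singleton yB.
  have xA' : nbhs x [set` `[p, q]].
    by apply: filterS xA => x' Ax'; have [] := AB (x', y) (conj Ax' By).
  have yB' : nbhs y [set` `[r, s]].
    by apply: filterS yB => y' By'; have [] := AB (x, y') (conj Ax By').
  have itvP (a b c : \bar R) : [set` `[a, b]] c -> a <= c /\ c <= b.
    by rewrite /= in_itv/= => /andP.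
  have xlt : x < +oo by apply: lt_le_trans xy (leey _).
  have ygt : -oo < y by apply: le_lt_trans (leNye _) xy.
  split.
  - have [xE|xN] := eqVneq x -oo.
      by right; have [] := itvP _ _ _ (nbhs_singleton xA'); rewrite xE leeNy_eq => /eqP.
    have [|x' x'x /itvP[px' _]] := nbhs_ex_lt _ xA'; first by rewrite ltNye.
    by left; exact: le_lt_trans x'x.
  - have [x' xx' /itvP[_ x'q]] := nbhs_ex_gt xlt xA'; exact: lt_le_trans x'q.
  - have [y' y'y /itvP[ry' _]] := nbhs_ex_lt ygt yB'; exact: le_lt_trans y'y.
  - have [yE|yN] := eqVneq y +oo.
      by right; have [] := itvP _ _ _ (nbhs_singleton yB'); rewrite yE leye_eq => _ /eqP.
    have [|y' yy' /itvP[_ y's]] := nbhs_ex_gt _ yB'; first by rewrite ltey.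
    by left; exact: lt_le_trans y's.
move=> [xp xq ry ys].
have itvE (a b : \bar R) : [set z | a <= z] `&` [set z | z <= b] = [set` `[a, b]].
  by apply/seteqP; split=> c /=; rewrite in_itv/= => /andP.
exists ([set` `[p, q]], [set` `[r, s]]); last by move=> [].
split; rewrite /= -itvE; apply: filterI.
- case: xp => [|->]; first exact: nbhs_gt_ereal.
  by apply: filterE => c; exact: leNye.
- exact: nbhs_lt_ereal.
- exact: nbhs_gt_ereal.
- case: ys => [|->]; first exact: nbhs_lt_ereal.
  by apply: filterE => c; exact: leey.
Qed.

End ExtendedReals.

(** * Rank functions of persistence modules and their stability *)

Section RankOfModule.
Variables (R : realType) (k : fieldType).
Implicit Types (V : persistence_module R k).
Local Open Scope ereal_scope.

(** The integer measures are nonnegative, so their minimum may be taken in [nat], and topological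
    interiors become inequalities. *)
Lemma dgmE V : rank_like (erank V) -> dgm V = diagram (erank V).
Proof.
move=> [_ _ Emu]; apply/funext => z; rewrite /dgm /diagram; case: ifP => // z12.
congr xget.
have aroundE m : rect_measures_around V z m <-> exists2 n, rect_count (erank V) z n & m = n%:Z.
  split.
    move=> [p [q [r [s [pq qr rs /(interior_rectP z12 pq rs)[zp zq rz zs] ->]]]]].
    have mu0 := Emu p q r s (ltW pq) qr (ltW rs).
    exists (erank V q r + erank V p s - (erank V p r + erank V q s))%N.
      by exists p, q, r, s; rewrite subnK.
    by rewrite /rect_measure -subzn// !PoszD; lia.
  move=> [n [p [q [r [s [[zp zq qr rz zs] nE]]]]] ->]; exists p, q, r, s; split=> //.
  - exact: lside_lt zp zq.
  - exact: rside_lt zs rz.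
  - by apply/interior_rectP => //; [exact: lside_lt zp zq|exact: rside_lt zs rz].
  - by rewrite /rect_measure; move: (erank V q r) (erank V p s) (erank V p r) (erank V q s) nE; lia.
apply/seteqP; split=> n [].
  move=> /aroundE[n' n'z [->]] nmin; split=> // m mz.
  by have := nmin m%:Z; rewrite lez_nat; apply; apply/aroundE; exists m.
move=> nz nmin; split; first by apply/aroundE; exists n.
by move=> m /aroundE[m' m'z ->]; rewrite lez_nat; exact: nmin.
Qed.

Definition extend_rank (rho : R -> R -> nat) (a b : \bar R) : nat :=
  match a, b with a'%:E, b'%:E => rho a' b' | _, _ => 0%N end.

Lemma extend_rank_like rho :
  (forall p q r s : R, (p <= q)%R -> (q < r)%R -> (r <= s)%R ->
    (rho p r + rho q s <= rho q r + rho p s)%N) ->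
  (forall p q r : R, (p <= q)%R -> (q < r)%R -> (rho p r <= rho q r)%N) ->
  (forall q r s : R, (q < r)%R -> (r <= s)%R -> (rho q s <= rho q r)%N) ->
  rank_like (extend_rank rho).
Proof.
move=> h1 h2 h3; split=> [b|a|]; first by case: b.
  by case: a.
move=> [p| |] [q| |] [r| |] [s| |]//=; rewrite ?lee_fin ?lte_fin ?addn0 ?add0n//.
- exact: h1.
- by move=> pq qr _; exact: h2.
- by move=> _; exact: h3.
Qed.

(** For definitions that match on [idP] to obtain a proof of [a <= b]: any other proof may be
    substituted, by irrelevance of boolean equalities. *)
Lemma if_reflect (b c : bool) (T : Type) (F : b -> T) (x : T) (r : reflect b c) (h : b) :
  (if r is ReflectT h' then F h' else x) = F h.
Proof. by case: r => // h'; congr F; exact: bool_irrelevance. Qed.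

Lemma erankE V (a b : R) (ab : (a <= b)%R) : erank V a%:E b%:E = rank (pm_map V ab).
Proof.
exact: (if_reflect (fun ab => rank (pm_map V ab)) 0%N idP ab).
Qed.

(** Frobenius for the three structure maps between [p <= q < r <= s]; q-tameness makes the middle
    one of finite rank. *)
Lemma erank_rank_like V : q_tame V -> rank_like (erank V).
Proof.
move=> Vq.
have -> : erank V = extend_rank (fun a b => erank V a%:E b%:E).
  by apply/funext => -[a| |]; apply/funext => -[b| |].
apply: extend_rank_like => [p q r s pq qr rs|p q r pq qr|q r s qr rs].
- have ps := le_trans pq (le_trans (ltW qr) rs).
  rewrite (erankE V (ltW qr)) (erankE V ps) (erankE V (le_trans pq (ltW qr))).
  rewrite (erankE V (le_trans (ltW qr) rs)).
  apply: (@frobenius _ _ _ _ _ (pm_map V pq) (pm_map V (ltW qr)) (pm_map V rs)) => [x|x|x|].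
  - by symmetry; exact: pm_map_comp.
  - by symmetry; exact: pm_map_comp.
  - by symmetry; exact: pm_map_comp.
  exact: Vq.
- rewrite (erankE V (ltW qr)) (erankE V (le_trans pq (ltW qr))).
  apply: (rank_compr (A := pm_map V pq) _ _).2 => [x|]; first by symmetry; exact: pm_map_comp.
  exact: Vq.
- rewrite (erankE V (ltW qr)) (erankE V (le_trans (ltW qr) rs)).
  apply: (rank_compl (C := pm_map V rs) _ _).2 => [x|]; first by symmetry; exact: pm_map_comp.
  exact: Vq.
Qed.

(** Maps are given for all [b >= a + eps], not only for equality, which avoids transport along
    equalities of real indices. The first two clauses are naturality, the last two the triangles. *)
Definition interleaving (U V : persistence_module R k) (eps : R)
    (f : forall a b : R, (a + eps <= b)%R -> {linear U a -> V b})
    (g : forall a b : R, (a + eps <= b)%R -> {linear V a -> U b}) :=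
  [/\ forall a' a b (a'a : (a' <= a)%R) (ab : (a + eps <= b)%R) (a'b : (a' + eps <= b)%R) x,
        f a b ab (pm_map U a'a x) = f a' b a'b x,
      forall a b b' (ab : (a + eps <= b)%R) (bb' : (b <= b')%R) (ab' : (a + eps <= b')%R) x,
        pm_map V bb' (f a b ab x) = f a b' ab' x,
      forall a b c (ab : (a + eps <= b)%R) (bc : (b + eps <= c)%R) (ac : (a <= c)%R) x,
        g b c bc (f a b ab x) = pm_map U ac x &
      forall a b c (ab : (a + eps <= b)%R) (bc : (b + eps <= c)%R) (ac : (a <= c)%R) x,
        f b c bc (g a b ab x) = pm_map V ac x].

Lemma algebraic_stability (U V : persistence_module R k) (eps : R) f g :
  (0 <= eps)%R -> q_tame U -> q_tame V -> interleaving (U := U) (V := V) (eps := eps) f g ->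
  exists M, is_matching (dgm U) (dgm V) eps M.
Proof.
move=> eps0 Uq Vq [fU fV gf fg].
rewrite !dgmE; try exact: erank_rank_like.
(* The mixed rank [r_I], of the map from [U a] to [V (b + eps)]; the default 0 is reached only for
   [b < a]. *)
pose rho (a b : R) :=
  if @idP (a + eps <= b + eps)%R is ReflectT ab then rank (f a (b + eps)%R ab) else 0%N.
have rhoE a b (ab : (a + eps <= b + eps)%R) : rho a b = rank (f a (b + eps)%R ab).
  exact: (if_reflect (fun ab => rank (f a (b + eps)%R ab)) 0%N idP ab).
have le_eps a b : (a < b)%R -> (a + eps <= b + eps)%R by move=> /ltW; rewrite lerD2r.
have rhoE' a b (ab : (a < b)%R) : rho a b = rank (f a (b + eps)%R (le_eps a b ab)) by [].
have ffin a b (ab : (a < b)%R) : exists n, has_rank (f a (b + eps)%R (le_eps a b ab)) n.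
  apply: (rank_compl (B := pm_map U (ltW ab)) (C := f b (b + eps)%R (lexx _)) _ _).1.
    by move=> x; symmetry; exact: fU.
  exact: Uq.
have rhomul p q r (pq : (p <= q)%R) (qr : (q < r)%R) : (rho p r <= rho q r)%N.
  have pr := le_lt_trans pq qr.
  rewrite (rhoE' _ _ qr) (rhoE' _ _ pr).
  by apply: (rank_compr (A := pm_map U pq) _ _).2 => // x; symmetry; exact: fU.
have rhomur q r s (qr : (q < r)%R) (rs : (r <= s)%R) : (rho q s <= rho q r)%N.
  have qs := lt_le_trans qr rs; have rs' : (r + eps <= s + eps)%R by rewrite lerD2r.
  rewrite (rhoE' _ _ qr) (rhoE' _ _ qs).
  by apply: (rank_compl (C := pm_map V rs') _ _).2 => // x; symmetry; exact: fV.
have Ifr : rank_like (extend_rank rho).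
  apply: extend_rank_like => // p q r s pq qr rs.
  have pr := le_lt_trans pq qr; have qs := lt_le_trans qr rs.
  have ps := le_lt_trans pq qs; have rs' : (r + eps <= s + eps)%R by rewrite lerD2r.
  rewrite (rhoE' _ _ pr) (rhoE' _ _ qs) (rhoE' _ _ qr) (rhoE' _ _ ps).
  have [fE gE] : (forall x, f p (r + eps)%R (le_eps p r pr) x =
      f q (r + eps)%R (le_eps q r qr) (pm_map U pq x)) /\
    (forall x, f q (s + eps)%R (le_eps q s qs) x =
      pm_map V rs' (f q (r + eps)%R (le_eps q r qr) x)).
    by split=> x; symmetry; [exact: fU|exact: fV].
  apply: (frobenius fE gE) => // x; by symmetry; exact: fV.
have leb (b : R) : (b + eps + eps <= b + 2 * eps)%R by lra.
(* Frobenius on [U p -> U q -> U b -> V (b + eps)]. *)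
have rank_q p q b (pq : (p <= q)%R) (qb : (q < b)%R) :
    (rho q b + erank U p%:E b%:E <= erank U q%:E b%:E + rho p b)%N.
  have pb := le_lt_trans pq qb.
  rewrite (rhoE' _ _ qb) (rhoE' _ _ pb) (erankE U (ltW qb)) (erankE U (ltW pb)) addnC.
  apply: (@frobenius _ _ _ _ _ (pm_map U pq) (pm_map U (ltW qb)) (f b (b + eps)%R (lexx _))).
  - by move=> x; symmetry; exact: pm_map_comp.
  - by move=> x; symmetry; exact: fU.
  - by move=> x; symmetry; exact: fU.
  - exact: Uq.
(* The case [p = -oo] of the previous inequality. [rank_k0] plays the same role below, and
   [rank_i0], [rank_c0] are cases [s = +oo]. *)
have rank_q0 q b (qb : (q < b)%R) : (rho q b <= erank U q%:E b%:E)%N.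
  rewrite (rhoE' _ _ qb) (erankE U (ltW qb)).
  apply: (rank_compl (C := f b (b + eps)%R (lexx _)) _ _).2; last exact: Uq.
  by move=> x; symmetry; exact: fU.
(* Frobenius on [U p -> U q -> V (b + eps) -> U (b + 2 eps)]. *)
have rank_k p q b (pq : (p <= q)%R) (qb : (q < b)%R) :
    (erank U q%:E (b + 2 * eps)%:E + rho p b <= rho q b + erank U p%:E (b + 2 * eps)%:E)%N.
  have pb := le_lt_trans pq qb.
  have qb2 : (q <= b + 2 * eps)%R by lra.
  have pb2 : (p <= b + 2 * eps)%R by lra.
  rewrite (rhoE' _ _ qb) (rhoE' _ _ pb) (erankE U qb2) (erankE U pb2) addnC.
  apply: (@frobenius _ _ _ _ _ (pm_map U pq) _ (g (b + eps)%R (b + 2 * eps)%R (leb b))) => [x|x|x|].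
  - by symmetry; exact: fU.
  - by symmetry; exact: gf.
  - by symmetry; exact: gf.
  - exact: ffin.
have rank_k0 q b (qb : (q < b)%R) : (erank U q%:E (b + 2 * eps)%:E <= rho q b)%N.
  have qb2 : (q <= b + 2 * eps)%R by lra.
  rewrite (rhoE' _ _ qb) (erankE U qb2).
  apply: (rank_compl (C := g (b + eps)%R (b + 2 * eps)%R (leb b)) _ _).2 => [x|];
    [by symmetry; exact: gf|exact: ffin].
(* Frobenius on [U a -> V (a + eps) -> V (r + eps) -> V (s + eps)]. *)
have rank_i a r s (ar : (a < r)%R) (rs : (r <= s)%R) :
    (rho a r + erank V (a + eps)%:E (s + eps)%:E <=
     erank V (a + eps)%:E (r + eps)%:E + rho a s)%N.
  have as' := lt_le_trans ar rs; have rs' : (r + eps <= s + eps)%R by rewrite lerD2r.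
  have are : (a + eps < r + eps)%R by rewrite ltrD2r.
  rewrite (rhoE' _ _ ar) (rhoE' _ _ as') (erankE V (ltW are)) (erankE V (le_eps _ _ as')).
  apply: (@frobenius _ _ _ _ _ (f a (a + eps)%R (lexx _)) (pm_map V (ltW are)) (pm_map V rs')).
  - by move=> x; symmetry; exact: fV.
  - by move=> x; symmetry; exact: pm_map_comp.
  - by move=> x; symmetry; exact: fV.
  - exact: Vq.
have rank_i0 a r (ar : (a < r)%R) : (rho a r <= erank V (a + eps)%:E (r + eps)%:E)%N.
  have are : (a + eps < r + eps)%R by rewrite ltrD2r.
  rewrite (rhoE' _ _ ar) (erankE V (ltW are)).
  apply: (rank_compr (A := f a (a + eps)%R (lexx _)) _ _).2; last exact: Vq.
  by move=> x; symmetry; exact: fV.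
have lea (a : R) : (a - 2 * eps + eps + eps <= a)%R by lra.
(* Frobenius on [V (a - eps) -> U a -> V (r + eps) -> V (s + eps)]; the index [a - 2 eps + eps] is
   left in the form produced by [shift_rank]. *)
have rank_c a r s (ar : (a < r)%R) (rs : (r <= s)%R) :
    (erank V (a - 2 * eps + eps)%:E (r + eps)%:E + rho a s <=
     rho a r + erank V (a - 2 * eps + eps)%:E (s + eps)%:E)%N.
  have as' := lt_le_trans ar rs; have rs' : (r + eps <= s + eps)%R by rewrite lerD2r.
  have ar' : (a - 2 * eps + eps <= r + eps)%R by lra.
  have as2 : (a - 2 * eps + eps <= s + eps)%R by lra.
  rewrite (rhoE' _ _ ar) (rhoE' _ _ as') (erankE V ar') (erankE V as2).
  apply: (@frobenius _ _ _ _ _ (g (a - 2 * eps + eps)%R a (lea a)) _ (pm_map V rs')) => [x|x|x|].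
  - by symmetry; exact: fg.
  - by symmetry; exact: fV.
  - by symmetry; exact: pm_map_comp.
  - exact: ffin.
have rank_c0 a r (ar : (a < r)%R) : (erank V (a - 2 * eps + eps)%:E (r + eps)%:E <= rho a r)%N.
  have ar' : (a - 2 * eps + eps <= r + eps)%R by lra.
  rewrite (rhoE' _ _ ar) (erankE V ar').
  apply: (rank_compr (A := g (a - 2 * eps + eps)%R a (lea a)) _ _).2 => [x|];
    [by symmetry; exact: fg|exact: ffin].
have Ufr := erank_rank_like Uq; have Vfr := erank_rank_like Vq.
have [U0 Uy _] := Ufr; have [I0 Iy _] := Ifr.
have [S0 Sy _] := shift_rank_like eps Vfr.
apply: (rank_matching (I := extend_rank rho)) => //.
- move=> [p| |] [q| |] [b| |]//; rewrite ?lee_fin ?lte_fin ?U0 ?Uy ?I0 ?Iy ?addn0//.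
  + exact: rank_q.
  + by move=> _; exact: rank_q0.
- move=> [p| |] [q| |] b//; rewrite ?lee_fin ?lte_fin ?U0 ?I0 ?addn0//.
  + exact: rank_k.
  + by move=> _; exact: rank_k0.
- move=> [a| |] [r| |] [s| |]//; rewrite ?lee_fin ?lte_fin ?S0 ?Sy ?I0 ?Iy ?addn0//.
  + exact: rank_i.
  + by move=> ar _; exact: rank_i0.
- move=> a [r| |] [s| |]//; rewrite ?lee_fin ?lte_fin ?Sy ?Iy ?addn0//.
  + exact: rank_c.
  + by move=> ar _; exact: rank_c0.
Qed.

End RankOfModule.

(** * Rips and Cech complexes *)

Section InclusionRank.
Variable k : fieldType.

Lemma quotmod_pi_sum (V : lmodType k) (W : submodClosed V) n (c : 'I_n -> k) (w : 'I_n -> V) :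
  \sum_i c i *: quotmod_pi W (w i) = quotmod_pi W (\sum_i c i *: w i).
Proof.
have pi0 : quotmod_pi W 0 = 0 by rewrite -[X in quotmod_pi W X](subrr 0) quotmod_piB subrr.
rewrite (big_morph (quotmod_pi W) (@quotmod_piD _ _ W) pi0).
by apply: eq_bigr => i _; rewrite quotmod_piZ.
Qed.

Lemma quotmod_pi_eq0 (V : lmodType k) (W : submodClosed V) v : v \in W -> quotmod_pi W v = 0.
Proof.
move=> vW; rewrite -[RHS](subrr (quotmod_pi W 0)) -quotmod_piB.
by apply/quotmod_eqP; rewrite !subr0.
Qed.

Lemma imfset_mono (X Y : choiceType) (f : X -> Y) (s t : {fset X}) :
  (s `<=` t)%fset -> ([fset f x | x in s] `<=` [fset f x | x in t])%fset.
Proof. by move=> /fsubsetP st; exact: subset_imfset. Qed.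

(** In [L] each cycle of [K] is homologous to its image under [nu], a chain on subsets of the finite
    set [N]. These chains form a space of finite dimension, which bounds the rank. *)
Lemma incl_finite_rank (X : choiceType) (K L : simplicial_complex X) (KL : K `<=` L)
    (nu : X -> X) (N : {fset X}) : (forall x, nu x \in N) ->
  (forall s, simplices K s -> simplices L (s `|` [fset nu x | x in s])%fset) ->
  exists n, has_rank (homology_incl k KL) n.
Proof.
move=> nuN nuKL; have [f [fc fnu]] := pushforward k nu.
pose D (s : {fset X}) := (s `|` [fset nu x | x in s])%fset.
have sD s : (s `<=` D s)%fset by exact: fsubsetUl.
have Dmono s t : (s `<=` t)%fset -> (D s `<=` D t)%fset.
  by move=> st; apply: fsetUSS => //; exact: imfset_mono.
have fD : carried D f.
  move=> s s0; apply: chain_onS (fnu s s0) => t [t0 tn]; split=> //.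
  exact: fsubset_trans tn (fsubsetUr _ _).
apply: (@has_rank_ex _ _ _ _ #|` fpowerset N|) => m e ie er.
have /choice[z zE] : forall i, exists z : Defs.cycle k K,
    e i = quotmod_pi _ (cycle_incl KL z).
  move=> i; have [u _ <-] := er i; exists (quotmod_repr u).
  by rewrite -{1}(quotmod_reprK u) [LHS]quotmod_map_pi.
have /choice[d dP] : forall i, exists d, is_chain L d /\ boundary d = f (z i) - z i.
  move=> i; have [d Ld db] := carried_homologous sD Dmono fc fD nuKL (valP (z i)).
  by exists d.
(* A relation among the chains [f (z i)] makes the same combination of the [z i] a boundary in [L],
   hence is a relation among the classes [e i]. *)
apply: (@indep_leq _ _ _ _ (fun i => f (z i)) (fun j => simplex (nth fset0 (fpowerset N) j))).
  move=> c cf0; apply: ie.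
  under eq_bigr do rewrite zE.
  rewrite quotmod_pi_sum; apply: quotmod_pi_eq0; apply/asboolP.
  exists (- \sum_i c i *: d i).
    rewrite -scaleN1r; apply: chain_onZ; apply: chain_on_sum => i _.
    by apply: chain_onZ; exact: (dP i).1.
  have -> : cycle_val (\sum_i c i *: cycle_incl KL (z i)) = \sum_i c i *: cycle_val (z i).
    rewrite -[LHS]/(val _) linear_sum; apply: eq_bigr => i _.
    by rewrite linearZ.
  have bd : boundary (\sum_i c i *: d i) = - \sum_i c i *: cycle_val (z i).
    rewrite linear_sum; transitivity (\sum_i (c i *: f (z i) - c i *: cycle_val (z i))).
      by apply: eq_bigr => i _; rewrite linearZ/= (dP i).2 scalerBr.
    by rewrite (sumrB _ _ (fun i => c i *: f (z i))) cf0 sub0r.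
  by rewrite linearN/= bd opprK.
move=> i; exists (fun j => mcoeff (nth fset0 (fpowerset N) j) (f (z i))).
rewrite [LHS](linear_linext idfun) (@linextEw _ _ _ _ (fpowerset N)).
  by rewrite (big_nth fset0) big_mkord.
apply/fsubsetP => t.
suff : chain_on [set t | (t `<=` N)%fset] (f (z i)) by move=> /[apply]; rewrite fpowersetE.
have /asboolP[Kz _] := valP (z i).
apply: (linear_chain_on (faces_neq0 Kz)) => s s0.
apply: chain_onS (fnu s s0) => u [_ us] /=; apply: (fsubset_trans us).
by apply/fsubsetP => _ /imfsetP[x _ ->].
Qed.

End InclusionRank.

(** * Interleavings of filtered complexes from vertex maps *)

Section FilteredComplexes.
Variables (R : realType) (k : fieldType).

Lemma chain_map_comp (X Y Z : choiceType) (f : {linear malg {fset X} k -> malg {fset Y} k})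
    (g : {linear malg {fset Y} k -> malg {fset Z} k}) :
  chain_map f -> chain_map g -> chain_map (g \o f).
Proof.
move=> [fb f0] [gb g0]; split; last by rewrite /= f0.
by move=> c; rewrite /= gb fb.
Qed.

Lemma round_trip_homologous (X Y : choiceType) (K L : simplicial_complex X)
    (phi : X -> Y) (psi : Y -> X)
    (f : {linear malg {fset X} k -> malg {fset Y} k})
    (g : {linear malg {fset Y} k -> malg {fset X} k}) z :
  chain_map f -> carried (fun s => [fset phi x | x in s]%fset) f ->
  chain_map g -> carried (fun s => [fset psi x | x in s]%fset) g ->
  (forall s, simplices K s ->
     simplices L (s `|` [fset psi y | y in [fset phi x | x in s]])%fset) ->
  is_cycle K z -> exists2 d, is_chain L d & boundary d = g (f z) - z.
Proof.
move=> fc fD gc gD Kac za.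
pose D (s : {fset X}) := (s `|` [fset psi y | y in [fset phi x | x in s]])%fset.
apply: (@carried_homologous _ _ _ _ D (g \o f)%R) za => //.
- by move=> s; exact: fsubsetUl.
- move=> s t st; apply: fsetUSS => //.
  by do 2 apply: imfset_mono.
- exact: chain_map_comp.
move=> s s0; apply: (linear_chain_on (fD s s0)) => t [t0 tphi].
apply: chain_onS (gD t t0) => u [u0 ut]; split=> //.
apply: (fsubset_trans ut); rewrite fsubsetU//; apply/orP; right.
exact: imfset_mono.
Qed.

Lemma homology_map_pi (X Y : choiceType) (K : simplicial_complex X)
    (L : simplicial_complex Y) (f : {linear malg {fset X} k -> malg {fset Y} k})
    (fKL : forall c, is_chain K c -> is_chain L (f c) /\ boundary (f c) = f (boundary c)) z :
  homology_map fKL (quotmod_pi _ z) = quotmod_pi _ (push_cycle fKL z).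
Proof. exact: quotmod_map_pi. Qed.

Lemma filtered_homology_pi (X : choiceType) (K : R -> simplicial_complex X)
    (K_mono : forall a b, a <= b -> K a `<=` K b) a b (ab : a <= b) z :
  pm_map (filtered_homology k K_mono) ab (quotmod_pi _ z) =
  quotmod_pi _ (cycle_incl (K_mono a b ab) z).
Proof. exact: quotmod_map_pi. Qed.

Section Interleaving.
Variables (X Y : choiceType) (KX : R -> simplicial_complex X) (KY : R -> simplicial_complex Y).
Variables (KX_mono : forall a b, a <= b -> KX a `<=` KX b).
Variables (KY_mono : forall a b, a <= b -> KY a `<=` KY b).
Variables (eps : R) (phi : X -> Y) (psi : Y -> X).
Hypothesis phiK : forall a b s, a + eps <= b -> simplices (KX a) s ->
  simplices (KY b) [fset phi x | x in s]%fset.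
Hypothesis psiK : forall a b s, a + eps <= b -> simplices (KY a) s ->
  simplices (KX b) [fset psi x | x in s]%fset.
Hypothesis psi_phiK : forall a b s, a + 2 * eps <= b -> simplices (KX a) s ->
  simplices (KX b) (s `|` [fset psi y | y in [fset phi x | x in s]])%fset.
Hypothesis phi_psiK : forall a b s, a + 2 * eps <= b -> simplices (KY a) s ->
  simplices (KY b) (s `|` [fset phi y | y in [fset psi x | x in s]])%fset.

(** Two chain maps, independent of the scale, induce all the homology maps. Naturality thus holds
    already on chains, and only the triangles need homotopies. *)
Lemma filtered_interleaving : exists f g,
  @interleaving R k (filtered_homology k KX_mono) (filtered_homology k KY_mono) eps f g.
Proof.
have [f0 [f0c f0D]] := pushforward k phi.
have [g0 [g0c g0D]] := pushforward k psi.
have fP a b (ab : a + eps <= b) c : is_chain (KX a) c ->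
    is_chain (KY b) (f0 c) /\ boundary (f0 c) = f0 (boundary c).
  move=> ca; split; last exact: chain_map_boundary f0c f0D (faces_neq0 ca).
  by apply: carried_is_chain f0D _ ca => s; exact: phiK.
have gP a b (ab : a + eps <= b) c : is_chain (KY a) c ->
    is_chain (KX b) (g0 c) /\ boundary (g0 c) = g0 (boundary c).
  move=> ca; split; last exact: chain_map_boundary g0c g0D (faces_neq0 ca).
  by apply: carried_is_chain g0D _ ca => s; exact: psiK.
exists (fun a b ab => homology_map (fP a b ab)), (fun a b ab => homology_map (gP a b ab)).
split.
- move=> a' a b a'a ab a'b x; move: (quotmod_repr x) (quotmod_reprK x) => z <-.
  rewrite filtered_homology_pi (homology_map_pi (fP a b ab)) (homology_map_pi (fP a' b a'b)).
  by congr quotmod_pi; exact/val_inj.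
- move=> a b b' ab bb' ab' x; move: (quotmod_repr x) (quotmod_reprK x) => z <-.
  rewrite (homology_map_pi (fP a b ab)) (homology_map_pi (fP a b' ab')) filtered_homology_pi.
  by congr quotmod_pi; exact/val_inj.
- move=> a b c ab bc ac x; move: (quotmod_repr x) (quotmod_reprK x) => z <-.
  rewrite (homology_map_pi (fP a b ab)) (homology_map_pi (gP b c bc)) filtered_homology_pi.
  apply/quotmod_eqP/asboolP; rewrite -[cycle_val _]/(g0 (f0 z) - z).
  have [|d dc db] := @round_trip_homologous X Y (KX a) (KX c) phi psi f0 g0 z
    f0c f0D g0c g0D _ (valP z).
    by move=> s; apply: psi_phiK; lra.
  by exists d.
- move=> a b c ab bc ac x; move: (quotmod_repr x) (quotmod_reprK x) => z <-.
  rewrite (homology_map_pi (gP a b ab)) (homology_map_pi (fP b c bc)) filtered_homology_pi.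
  apply/quotmod_eqP/asboolP; rewrite -[cycle_val _]/(f0 (g0 z) - z).
  have [|d dc db] := @round_trip_homologous Y X (KY a) (KY c) psi phi g0 f0 z
    g0c g0D f0c f0D _ (valP z).
    by move=> s; apply: phi_psiK; lra.
  by exists d.
Qed.

End Interleaving.
End FilteredComplexes.

(** * Rips and Cech filtrations of metric spaces *)

Section Complexes.
Variables (R : realType) (k : fieldType).

(** Points are moved to a finite [(b - a) / 2]-net; adding the moved vertices costs twice that
    amount, exactly the room between [a] and [b]. *)
Lemma totally_bounded_q_tame (X : metricType R) (K : R -> simplicial_complex X)
    (K_mono : forall a b, a <= b -> K a `<=` K b) : totally_bounded X ->
  (forall (a b eta : R) (nu : X -> X) s, (forall x, mdist x (nu x) <= eta) ->
     a + 2 * eta <= b -> simplices (K a) s ->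
     simplices (K b) (s `|` [fset nu x | x in s])%fset) ->
  q_tame (filtered_homology k K_mono).
Proof.
move=> Xtb nuK a b ab a_lt_b; have ba2 : 0 < (b - a) / 2 by rewrite divr_gt0// subr_gt0.
have [F Ffin FX] := Xtb _ ba2.
have /choice[nu nuP] : forall x, exists y, F y /\ mdist x y < (b - a) / 2.
  by move=> x; have [y Fy xy] := FX x; exists y.
apply: (@incl_finite_rank k X (K a) (K b) (K_mono a b ab) nu (fset_set F)) => [x|s].
  by rewrite in_fset_set// inE; exact: (nuP x).1.
apply: (nuK a b ((b - a) / 2)) => [x|]; first exact/ltW/(nuP x).2.
by rewrite mulrC divfK ?subrKC.
Qed.

Lemma rips_q_tame (X : metricType R) : totally_bounded X -> q_tame (rips_homology X k).
Proof.
move=> Xtb; apply: totally_bounded_q_tame => // a b eta nu s nueta ab [s0 sa].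
have near x : x \in (s `|` [fset nu x | x in s])%fset -> exists2 x', x' \in s & mdist x x' <= eta.
  rewrite in_fsetU => /orP[xs|/imfsetP[x' /= x's ->]]; last first.
    by exists x' => //; rewrite metric_sym.
  by exists x => //; rewrite mdistxx (le_trans _ (nueta x))// mdist_ge0.
split; first by rewrite -fsubset0 fsubUset negb_and fsubset0 s0.
move=> x y /near[x' x's xx'] /near[y' y's yy'].
have := metric_triangle x x' y; have := metric_triangle x' y' y.
have := sa _ _ x's y's; rewrite (metric_sym y' y); lra.
Qed.

(** The common point [z] of the balls is kept: moved vertices are within [a + eta] of it. *)
Lemma cech_q_tame (X : metricType R) : totally_bounded X -> q_tame (cech_homology X k).
Proof.
move=> Xtb; apply: totally_bounded_q_tame => // a b eta nu s nueta ab [s0 [z sz]].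
split; first by rewrite -fsubset0 fsubUset negb_and fsubset0 s0.
exists z => x /=; have eta0 : 0 <= eta by apply: le_trans (nueta z); exact: mdist_ge0.
rewrite in_fsetU => /orP[xs|/imfsetP[x' /= x's ->]]; rewrite /closed_metric_ball/=.
  have : mdist x z <= a := sz x xs; lra.
have : mdist x' z <= a := sz x' x's; have := metric_triangle (nu x') x' z.
have := nueta x'; rewrite (metric_sym x' (nu x')); lra.
Qed.

Definition distortion_le (X Y : metricType R) (C : X -> Y -> Prop) (eps : R) :=
  forall x y x' y', C x y -> C x' y' -> `|mdist x x' - mdist y y'| <= eps.

Lemma distortion_le_sym (X Y : metricType R) (C : X -> Y -> Prop) eps :
  distortion_le C eps -> distortion_le (fun y x => C x y) eps.
Proof. by move=> Ce y x y' x' xy xy'; rewrite distrC; exact: Ce. Qed.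

Section Correspondence.
Variables (X Y : metricType R) (C : X -> Y -> Prop) (eps : R) (phi : X -> Y) (psi : Y -> X).
Hypotheses (Ceps : distortion_le C eps) (Cphi : forall x, C x (phi x))
  (Cpsi : forall y, C (psi y) y).

Lemma mdist_corr x y x' y' : C x y -> C x' y' -> mdist y y' <= mdist x x' + eps.
Proof.
move=> xy xy'; have := Ceps xy xy'; rewrite distrC.
have := ler_norm (mdist y y' - mdist x x'); lra.
Qed.

Lemma mdist_corr' x y x' y' : C x y -> C x' y' -> mdist x x' <= mdist y y' + eps.
Proof.
move=> xy xy'; have := Ceps xy xy'.
have := ler_norm (mdist x x' - mdist y y'); lra.
Qed.

Lemma rips_corr a b s : a + eps <= b -> simplices (Rips X a) s ->
  simplices (Rips Y b) [fset phi x | x in s]%fset.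
Proof.
move=> ab [s0 sa]; split.
  have [x xs] := fset0Pn _ s0.
  by apply/fset0Pn; exists (phi x); rewrite in_imfset.
move=> _ _ /imfsetP[x /= xs ->] /imfsetP[x' /= x's ->].
have := mdist_corr (Cphi x) (Cphi x'); have := sa _ _ xs x's; lra.
Qed.

Lemma cech_corr a b s : a + eps <= b -> simplices (Cech X a) s ->
  simplices (Cech Y b) [fset phi x | x in s]%fset.
Proof.
move=> ab [s0 [z sz]]; split.
  have [x xs] := fset0Pn _ s0.
  by apply/fset0Pn; exists (phi x); rewrite in_imfset.
exists (phi z) => _ /imfsetP[x /= xs ->].
have xz : mdist x z <= a := sz x xs.
by have := mdist_corr (Cphi x) (Cphi z); rewrite /closed_metric_ball/=; lra.
Qed.

(** Both [x] and [psi (phi x)] correspond to [phi x]. Distances among old and new vertices are thus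
    compared through [Y], at a cost of [eps] each way. *)
Lemma round_trip_near (s : {fset X}) u :
  u \in (s `|` [fset psi y | y in [fset phi x | x in s]])%fset ->
  exists2 x, x \in s & C u (phi x).
Proof.
rewrite in_fsetU => /orP[us|/imfsetP[y /= /imfsetP[x /= xs ->] ->]]; first by exists u.
by exists x.
Qed.

Lemma rips_round_trip a b s : a + 2 * eps <= b -> simplices (Rips X a) s ->
  simplices (Rips X b) (s `|` [fset psi y | y in [fset phi x | x in s]])%fset.
Proof.
move=> ab [s0 sa]; split; first by rewrite -fsubset0 fsubUset negb_and fsubset0 s0.
move=> u u' /round_trip_near[x xs ux] /round_trip_near[x' x's ux'].
have := mdist_corr' ux ux'; have := mdist_corr (Cphi x) (Cphi x').
have := sa _ _ xs x's; lra.
Qed.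

Lemma cech_round_trip a b s : a + 2 * eps <= b -> simplices (Cech X a) s ->
  simplices (Cech X b) (s `|` [fset psi y | y in [fset phi x | x in s]])%fset.
Proof.
move=> ab [s0 [z sz]]; split; first by rewrite -fsubset0 fsubUset negb_and fsubset0 s0.
exists z => u /round_trip_near[x xs ux].
have xz : mdist x z <= a := sz x xs.
have := mdist_corr' ux (Cphi z); have := mdist_corr (Cphi x) (Cphi z).
by rewrite /closed_metric_ball/=; lra.
Qed.

End Correspondence.

Lemma distortion_ge0 (X Y : metricType R) (C : set (X * Y)) : (0 <= distortion C)%E.
Proof. by apply: ereal_sup_ubound; left. Qed.

Lemma distortion_leP (X Y : metricType R) (C : set (X * Y)) (eps : R) :
  (distortion C <= eps%:E)%E -> distortion_le (fun x y => C (x, y)) eps.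
Proof.
move=> Ce x y x' y' xy xy'; rewrite -lee_fin; apply: le_trans Ce.
by apply: ereal_sup_ubound; right; exists (x, y) => //; exists (x', y').
Qed.

Lemma correspondence_choice (X Y : metricType R) (C : set (X * Y)) : correspondence C ->
  exists phi psi, (forall x, C (x, phi x)) /\ (forall y, C (psi y, y)).
Proof.
by move=> [/choice[phi Cphi] /choice[psi Cpsi]]; exists phi, psi.
Qed.

(** The factor 2 cancels the half in the definition, leaving an infimum over correspondences;
    infinite distortion gives a trivial bound. *)
Lemma bottleneck_le_gromov_hausdorff (X Y : metricType R) (A B : multiset R) :
  (forall (C : set (X * Y)) (eps : R), correspondence C -> (distortion C = eps%:E)%E ->
     exists M, is_matching A B eps M) ->
  (bottleneck A B <= 2%:E * gromov_hausdorff X Y)%E.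
Proof.
move=> CM; rewrite /gromov_hausdorff muleA -EFinM mulfV ?pnatr_eq0// mul1e.
apply/ereal_infP => _ [C Ccorr <-].
case E : (distortion C) => [eps| |]; last 2 first.
- exact: leey.
- by have := distortion_ge0 C; rewrite E leeNy_eq.
apply: ereal_inf_lbound; exists eps => //; split; last exact: CM Ccorr E.
by have := distortion_ge0 C; rewrite E lee_fin.
Qed.

End Complexes.

Theorem theorem5p2 (R : realType) (k : fieldType) (X Y : metricType R)
    (hX : totally_bounded X) (hY : totally_bounded Y) :
  (bottleneck (dgm (rips_homology X k)) (dgm (rips_homology Y k))
     <= 2%:E * gromov_hausdorff X Y)%E /\
  (bottleneck (dgm (cech_homology X k)) (dgm (cech_homology Y k))
     <= 2%:E * gromov_hausdorff X Y)%E.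
Proof.
split; apply: bottleneck_le_gromov_hausdorff => C eps Ccorr Ceps.
all: have eps0 : 0 <= eps by rewrite -lee_fin -Ceps distortion_ge0.
all: have [phi [psi [Cphi Cpsi]]] := correspondence_choice Ccorr.
all: have {}Ceps : distortion_le (fun x y => C (x, y)) eps by apply: distortion_leP; rewrite Ceps.
(* The transposed correspondence serves the same lemmas with [X] and [Y] exchanged. *)
all: have Csym := distortion_le_sym Ceps.
- have [] := @filtered_interleaving R k X Y _ _ (@Rips_mono R X) (@Rips_mono R Y) eps phi psi.
  + exact: rips_corr Ceps Cphi.
  + exact: rips_corr Csym Cpsi.
  + exact: rips_round_trip Ceps Cphi Cpsi.
  + exact: rips_round_trip Csym Cpsi Cphi.
  by move=> f [g fg]; apply: algebraic_stability fg => //; exact: rips_q_tame.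
- have [] := @filtered_interleaving R k X Y _ _ (@Cech_mono R X) (@Cech_mono R Y) eps phi psi.
  + exact: cech_corr Ceps Cphi.
  + exact: cech_corr Csym Cpsi.
  + exact: cech_round_trip Ceps Cphi Cpsi.
  + exact: cech_round_trip Csym Cpsi Cphi.
  by move=> f [g fg]; apply: algebraic_stability fg => //; exact: cech_q_tame.
Qed.
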